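(* Assume that: (Hp1) $H$ is a real Hilbert space, and $A$ is a self-adjoint nonnegative linear operator on $H$ with dense domain $D(A)$; (Hp2) $F:D(A^{1/2})\to[0,+\infty)$ is a nonnegative function with $F(0)=0$; (Hp3) $F$ has a gradient $\nabla F:D(A^{1/2})\to H$, in the sense that for every $u\in D(A^{1/2})$ $$\lim_{|v|_{D(A^{1/2})}\to 0}\frac{F(u+v)-F(u)-\langle\nabla F(u),v\rangle}{|v|}=0;$$ (Hp4) $\nabla F$ is locally Lipschitz continuous, in the sense that there is a function $L:\mathbb{R}^2\to\mathbb{R}$, bounded on bounded sets, such that $$|\nabla F(u)-\nabla F(v)|\leq L\left(|u|_{D(A^{1/2})},|v|_{D(A^{1/2})}\right)\cdot|u-v|_{D(A^{1/2})}\qquad\forall u,v\in D(A^{1/2}).$$ Assume in addition that $\ker A\neq\{0\}$, that there exists $\nu>0$ such that $$|A^{1/2}u|^2\geq\nu|u|^2\qquad\forall u\in D(A^{1/2})\cap(\ker A)^{\perp},$$ and, for a given real number $p>0$, that there exist real numbers $\rho>0$, $R>0$, $\alpha>0$ such that $$|\nabla F(u)|\leq R\left(|u|^{p+1}+|A^{1/2}u|^{1+\alpha}\right)$$ for every $u\in D(A^{1/2})$ with $|u|_{D(A^{1/2})}\leq\rho$. Then there exist a nonempty open set $\mathcal{S}\subseteq D(A^{1/2})\times H$ and a constant $M_3>0$ such that, for every $(u_0,u_1)\in\mathcal{S}$, the unique global weak solution $u\in C^0([0,+\infty);D(A^{1/2}))\cap C^1([0,+\infty);H)$ of $$u''(t)+u'(t)+Au(t)+\nabla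 F(u(t))=0\quad\forall t\ge 0,\qquad u(0)=u_0,\quad u'(0)=u_1$$ satisfies $$|u(t)|\geq\frac{M_3}{(1+t)^{1/p}}\qquad\forall t\geq 0.$$
   Context: $|\cdot|$ and $\langle\cdot,\cdot\rangle$ denote the norm and scalar product of $H$. $A$ nonnegative means $\langle Au,u\rangle\ge 0$ for all $u\in D(A)$, and $D(A^{1/2})$ is a Hilbert space with norm $|u|_{D(A^{1/2})}:=(|u|^2+|A^{1/2}u|^2)^{1/2}$. Weak solution: writing $U=(u,u')$, $\mathcal{H}=D(A^{1/2})\times H$ with its product norm, $\mathcal{A}(u,v)=(-v,Au+u)$ with domain $D(A)\times D(A^{1/2})$ (a skew-adjoint operator on $\mathcal{H}$) and $\mathcal{F}(u,v)=(0,u-\nabla F(u)-v)$, $u$ is a weak solution on an interval $[0,T)$ (with $T\le+\infty$) if $u\in C^0([0,T);D(A^{1/2}))\cap C^1([0,T);H)$ and $U$ is a mild solution of $U'+\mathcal{A}U=\mathcal{F}(U)$, $U(0)=(u_0,u_1)$, i.e. $U(t)=e^{-t\mathcal{A}}U(0)+\int_0^te^{-(t-s)\mathcal{A}}\mathcal{F}(U(s))\,ds$ for every $t\in[0,T)$. Under (Hp1)-(Hp4), for every $(u_0,u_1)\in D(A^{1/2})\times H$ the problem has a unique global weak solution (i.e. with $T=+\infty$). *)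

(* Defs.v *)
From Stdlib Require Import Reals Lra ProofIrrelevance.
From Coquelicot Require Import Coquelicot.
Open Scope R_scope.
Set Implicit Arguments.
Unset Strict Implicit.

Record Hilbert : Type := MkHilbert {
  hspace :> CompleteNormedModule R_AbsRing;
  inner : hspace -> hspace -> R;
  inner_sym : forall x y, inner x y = inner y x;
  inner_plus_l : forall x y z, inner (plus x y) z = inner x z + inner y z;
  inner_scal_l : forall k x y, inner (scal k x) y = k * inner x y;
  inner_norm : forall x, inner x x = norm x ^ 2
}.
Arguments inner {h} x y.

(** Possibly unbounded linear operators. [app] is a total function whose
    values outside [dom] are never used. *)
Record linear_op (H : Hilbert) : Type := MkLinearOp {
  dom : H -> Prop;
  app :> H -> H;
  dom_zero : dom zero;
  dom_plus : forall x y, dom x -> dom y -> dom (plus x y);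
  dom_scal : forall (k : R) x, dom x -> dom (scal k x);
  app_plus : forall x y, dom x -> dom y -> app (plus x y) = plus (app x) (app y);
  app_scal : forall (k : R) x, dom x -> app (scal k x) = scal k (app x)
}.

Section Operators.
Variable H : Hilbert.
Implicit Types A B : linear_op H.

Definition densely_defined A : Prop :=
  forall (x : H) (eps : R), 0 < eps -> exists y, dom A y /\ norm (minus y x) < eps.

(** [(v, w)] lies in the graph of the adjoint of [A]. *)
Definition adjoint_graph A (v w : H) : Prop :=
  forall u, dom A u -> inner (A u) v = inner u w.

Definition self_adjoint A : Prop :=
  densely_defined A /\
  forall v w, adjoint_graph A v w <-> (dom A v /\ A v = w).

Definition nonnegative A : Prop := forall u, dom A u -> 0 <= inner (A u) u.

(** [B] is the nonnegative self-adjoint square root of [A]; the domain of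
    [B^2] is that of the composition of unbounded operators. *)
Definition is_op_sqrt A B : Prop :=
  self_adjoint B /\ nonnegative B /\
  (forall u, dom A u <-> (dom B u /\ dom B (B u))) /\
  (forall u, dom A u -> A u = B (B u)).

Definition in_ker A (u : H) : Prop := dom A u /\ A u = zero.

Definition in_ker_orth A (u : H) : Prop := forall w, in_ker A w -> inner u w = 0.

End Operators.

(** The domain of [B] as a normed space with the graph norm
    [(|u|^2 + |B u|^2)^(1/2)]. *)
Record dom_space (H : Hilbert) (B : linear_op H) : Type := MkDom {
  incl : H;
  incl_dom : dom B incl
}.
Arguments incl {H B} d.

Section DomSpace.
Variables (H : Hilbert) (B : linear_op H).
Notation V := (dom_space B).

Lemma incl_inj (x y : V) : incl x = incl y -> x = y.
Proof.
destruct x as [x hx], y as [y hy]; simpl; intros <-.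
now rewrite (proof_irrelevance _ hx hy).
Qed.

Definition dplus (x y : V) : V :=
  MkDom (dom_plus (incl_dom x) (incl_dom y)).
Definition dzero : V := MkDom (dom_zero B).
Definition dscal (k : R) (x : V) : V := MkDom (dom_scal k (incl_dom x)).

Lemma dom_opp (x : H) : dom B x -> dom B (opp x).
Proof. intro h.
exact (eq_ind _ (dom B) (dom_scal (opp (one : R_Ring)) h) _
         (scal_opp_one (V := H) x)). Qed.

Definition dopp (x : V) : V := MkDom (dom_opp (incl_dom x)).

Lemma dplus_comm (x y : V) : dplus x y = dplus y x.
Proof. apply incl_inj, plus_comm. Qed.
Lemma dplus_assoc (x y z : V) : dplus x (dplus y z) = dplus (dplus x y) z.
Proof. apply incl_inj, plus_assoc. Qed.
Lemma dplus_zero_r (x : V) : dplus x dzero = x.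
Proof. apply incl_inj, plus_zero_r. Qed.
Lemma dplus_opp_r (x : V) : dplus x (dopp x) = dzero.
Proof. apply incl_inj. exact (plus_opp_r (incl x)). Qed.

Definition dom_AbelianMonoid_mixin :=
  AbelianMonoid.Mixin V dplus dzero dplus_comm dplus_assoc dplus_zero_r.
Canonical dom_AbelianMonoid := AbelianMonoid.Pack V dom_AbelianMonoid_mixin V.
Definition dom_AbelianGroup_mixin :=
  AbelianGroup.Mixin dom_AbelianMonoid dopp dplus_opp_r.
Canonical dom_AbelianGroup :=
  AbelianGroup.Pack V
    (AbelianGroup.Class _ dom_AbelianMonoid_mixin dom_AbelianGroup_mixin) V.

Lemma dscal_assoc (k l : R) (x : V) :
  dscal k (dscal l x) = dscal (mult (k : R_Ring) l) x.
Proof. apply incl_inj. exact (scal_assoc (V := H) k l (incl x)). Qed.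
Lemma dscal_one (x : V) : dscal (one : R_Ring) x = x.
Proof. apply incl_inj. exact (scal_one (V := H) (incl x)). Qed.
Lemma dscal_distr_l (k : R) (x y : V) :
  dscal k (plus x y) = plus (dscal k x) (dscal k y).
Proof. apply incl_inj. exact (scal_distr_l (V := H) k (incl x) (incl y)). Qed.
Lemma dscal_distr_r (k l : R) (x : V) :
  dscal (plus (k : R_Ring) l) x = plus (dscal k x) (dscal l x).
Proof. apply incl_inj. exact (scal_distr_r (V := H) k l (incl x)). Qed.

Definition dom_ModuleSpace_mixin :=
  ModuleSpace.Mixin R_Ring dom_AbelianGroup dscal
    dscal_assoc dscal_one dscal_distr_l dscal_distr_r.
Canonical dom_ModuleSpace :=
  ModuleSpace.Pack R_Ring V
    (ModuleSpace.Class R_Ring V (AbelianGroup.class dom_AbelianGroup)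
       dom_ModuleSpace_mixin) V.

Definition dnorm (x : V) : R := sqrt (norm (incl x) ^ 2 + norm (B (incl x)) ^ 2).

Definition dgraph (x : V) : H * H := (incl x, B (incl x)).

Lemma dgraph_plus (x y : V) : dgraph (plus x y) = plus (dgraph x) (dgraph y).
Proof.
apply injective_projections; simpl; [reflexivity|].
apply app_plus; apply incl_dom.
Qed.

Lemma dgraph_scal (k : R) (x : V) : dgraph (scal k x) = scal k (dgraph x).
Proof.
apply injective_projections; simpl; [reflexivity|].
apply app_scal; apply incl_dom.
Qed.

Lemma dnorm_graph (x : V) : dnorm x = norm (dgraph x).
Proof. reflexivity. Qed.

Lemma dnorm_triangle (x y : V) : dnorm (plus x y) <= dnorm x + dnorm y.
Proof. rewrite !dnorm_graph, dgraph_plus; apply (norm_triangle (dgraph x)). Qed.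

Lemma dnorm_scal (k : R) (x : V) : dnorm (scal k x) <= abs k * dnorm x.
Proof. rewrite !dnorm_graph, dgraph_scal; apply (norm_scal k (dgraph x)). Qed.

Lemma dnorm_eq_zero (x : V) : dnorm x = 0 -> x = zero.
Proof.
rewrite dnorm_graph; intro h; apply incl_inj.
exact (f_equal fst (norm_eq_zero _ h)).
Qed.

Lemma dnorm_zero : dnorm zero = 0.
Proof.
apply Rle_antisym; [|apply sqrt_pos].
rewrite <- (Rmult_0_l (dnorm zero)).
replace (zero : V) with (dscal 0 zero : V) at 1.
- eapply Rle_trans; [apply (dnorm_scal 0)|].
  change (Rabs 0 * dnorm zero <= 0 * dnorm zero).
  rewrite Rabs_R0; lra.
- apply incl_inj. exact (scal_zero_l (V := H) _).
Qed.

Lemma dnorm_minus_sym (x y : V) : dnorm (minus x y) = dnorm (minus y x).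
Proof.
cut (forall a b : V, dnorm (minus a b) <= dnorm (minus b a)).
{ intro h; apply Rle_antisym; apply h. }
intros a b.
replace (minus a b) with (scal (- (1)) (minus b a) : V).
- eapply Rle_trans; [apply dnorm_scal|].
  change (Rabs (- (1)) * dnorm (minus b a) <= dnorm (minus b a)).
  rewrite Rabs_Ropp, Rabs_R1; lra.
- transitivity (opp (minus b a) : V); [exact (scal_opp_one (minus b a))|].
  apply (opp_minus b a).
Qed.

Definition dball (x : V) (e : R) (y : V) : Prop := dnorm (minus y x) < e.

Lemma dball_center (x : V) (e : posreal) : dball x e x.
Proof.
unfold dball.
replace (minus x x) with (zero : V) by (symmetry; exact (plus_opp_r x)).
rewrite dnorm_zero; apply cond_pos.
Qed.
Lemma dball_sym (x y : V) (e : R) : dball x e y -> dball y e x.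
Proof. unfold dball; now rewrite dnorm_minus_sym. Qed.
Lemma dball_triangle (x y z : V) (e1 e2 : R) :
  dball x e1 y -> dball y e2 z -> dball x (e1 + e2) z.
Proof.
unfold dball; intros h1 h2.
rewrite (minus_trans y z x : minus z x = plus (minus z y) (minus y x)).
eapply Rle_lt_trans; [apply dnorm_triangle|]; lra.
Qed.

Definition dom_UniformSpace_mixin :=
  UniformSpace.Mixin V dzero dball dball_center dball_sym dball_triangle.
Canonical dom_UniformSpace := UniformSpace.Pack V dom_UniformSpace_mixin V.
Canonical dom_NormedModuleAux :=
  NormedModuleAux.Pack R_AbsRing V
    (NormedModuleAux.Class R_AbsRing V (ModuleSpace.class R_Ring dom_ModuleSpace)
       dom_UniformSpace_mixin) V.

Lemma dnorm_compat1 (x y : V) (e : R) : dnorm (minus y x) < e -> ball x e y.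
Proof. exact (fun h => h). Qed.
Lemma dnorm_compat2 (x y : V) (e : posreal) :
  ball x e y -> dnorm (minus y x) < 1 * e.
Proof. intro h; rewrite Rmult_1_l; exact h. Qed.

Definition dom_NormedModule_mixin :=
  NormedModule.Mixin R_AbsRing dom_NormedModuleAux dnorm 1
    dnorm_triangle dnorm_scal dnorm_compat1 dnorm_compat2 dnorm_eq_zero.
Canonical dom_NormedModule :=
  NormedModule.Pack R_AbsRing V
    (NormedModule.Class R_AbsRing V (NormedModuleAux.class R_AbsRing dom_NormedModuleAux)
       dom_NormedModule_mixin) V.

End DomSpace.

(** [E] is the strongly continuous semigroup [t |-> exp (t G)], where the
    generator [G] is given by its graph; only [E t] with [t >= 0] matters. *)
Definition generates (X : NormedModule R_AbsRing) (G : X -> X -> Prop)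
    (E : R -> X -> X) : Prop :=
  (forall t, 0 <= t -> is_linear (E t)) /\
  (forall x, E 0 x = x) /\
  (forall s t x, 0 <= s -> 0 <= t -> E (s + t) x = E s (E t x)) /\
  (forall x, filterlim (fun t => E t x) (at_right 0) (locally x)) /\
  (forall x y, G x y <->
     filterlim (fun h => scal (/ h) (minus (E h x) x)) (at_right 0) (locally y)).

Section Evolution.
Variables (H : Hilbert) (A B : linear_op H).

(** [D(A^{1/2}) x H]; the norm of a product in Coquelicot is
    [(|u|^2 + |v|^2)^(1/2)]. *)
Definition phase_space : NormedModule R_AbsRing :=
  prod_NormedModule R_AbsRing (dom_NormedModule B) H.

(** Graph of the operator [(u, v) |-> (-v, A u + u)] with domain
    [D(A) x D(A^{1/2})]. That [v] lies in [D(A^{1/2})] is expressed by the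
    first component of the image being an element of [dom_space B]. *)
Definition wave_graph (x y : phase_space) : Prop :=
  dom A (incl (fst x)) /\
  incl (fst y) = opp (snd x) /\
  snd y = plus (A (incl (fst x))) (incl (fst x)).

Definition wave_force (gradF : dom_space B -> H) (x : phase_space) : phase_space :=
  (zero, minus (minus (incl (fst x)) (gradF (fst x))) (snd x)).

(** [U] is a mild solution of [U' + W U = f(U)] on [[0, +oo)], with [W] given
    by its graph. *)
Definition mild_solution (X : NormedModule R_AbsRing) (W : X -> X -> Prop)
    (f : X -> X) (U : R -> X) : Prop :=
  exists E : R -> X -> X,
    generates (fun x y => W x (opp y)) E /\
    forall t, 0 <= t ->
      is_RInt (fun s => E (t - s) (f (U s))) 0 t (minus (U t) (E t (U 0))).

(** Global weak solution; values of [u] at negative times are irrelevant. *)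
Definition global_weak_solution (gradF : dom_space B -> H)
    (u0 : dom_space B) (u1 : H) (u : R -> dom_space B) : Prop :=
  continuous_on (Rle 0) u /\
  exists u' : R -> H,
    (forall t, 0 <= t ->
       filterdiff (fun s => incl (u s)) (within (Rle 0) (locally t))
         (fun h => scal h (u' t))) /\
    continuous_on (Rle 0) u' /\
    u 0 = u0 /\ u' 0 = u1 /\
    mild_solution wave_graph (wave_force gradF)
      (fun t => (u t, u' t) : phase_space).

Definition is_gradient (F : dom_space B -> R) (gradF : dom_space B -> H) : Prop :=
  forall u : dom_space B,
    filterlim
      (fun v : dom_space B =>
         (F (plus u v) - F u - inner (gradF u) (incl v)) / norm (incl v))
      (locally' (zero : dom_space B)) (locally 0).

Definition bounded_on_bounded (L : R -> R -> R) : Prop :=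
  forall r, exists M, forall a b, Rabs a <= r -> Rabs b <= r -> Rabs (L a b) <= M.

Definition locally_lipschitz (gradF : dom_space B -> H) : Prop :=
  exists L : R -> R -> R,
    bounded_on_bounded L /\
    forall u v : dom_space B,
      norm (minus (gradF u) (gradF v)) <= L (norm u) (norm v) * norm (minus u v).

End Evolution.

(** Real powers of nonnegative numbers with positive exponent: [Rpower 0 y] is
    [1] and not [0]. *)
Definition rpow (x y : R) : R := if Rle_dec x 0 then 0 else Rpower x y.

(* Main.v *)
Require Import Defs.
From Stdlib Require Import Reals Lra Lia.
From Stdlib Require Import ClassicalEpsilon FunctionalExtensionality PropExtensionality.
From Coquelicot Require Import Coquelicot.
From Corelib Require Import ssreflect.
Open Scope R_scope.
Close Scope boolean_if_scope.
Open Scope general_if_scope.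

(** Write B = A^(1/2), let Q be the orthogonal projection onto (ker A)^⊥, and set
    e = |u'|^2 + |B u|^2. Along a solution e + 2 F(u) does not increase, and the
    corrected energy Phi = e + 2 delta <u', Q u> is equivalent to e and satisfies
    Phi' <= - k Phi + C |u|^(2p+2) while |u| is small, because the spectral gap
    controls Q u and the growth condition controls the gradient of F. For a suitable K
    the region Phi < K |u|^(2p+2) is then invariant: on its boundary Phi' is too negative
    as long as |u| <= eps, and for |u| >= eps the smallness of the initial energy alone
    gives Phi < K eps^(2p+2). No a priori bound on |u| is needed. Inside the region
    |u'| <= c |u|^(p+1), so |u|^(-p) grows at most linearly. The set S is a neighbourhood
    of a small nonzero element of ker A with zero velocity.

    The derivatives of Phi are justified for mild solutions as follows. The semigroup is
    locally bounded (uniform boundedness), its generator is densely defined and skew, so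
    it is isometric; hence U(t+h) - E(h) U(t) = h f(t) + o(h) yields the right derivative
    of |U|^2, and pairing with (0, phi) yields the weak form of the equation. *)

(** * Hilbert spaces *)

(** Two points shape the argument. A mild solution has no second derivative and its velocity lies
    only in H, so one can differentiate |U|^2, and <u', phi> for a fixed phi in D(B), but not <u', Q
    u> directly. Its increment is therefore computed with the test vector frozen at time t + h;
    since B Q = B on D(B), every term that appears is continuous in time. Right derivatives are
    enough because a continuous function with a continuous right derivative is of class C^1. The
    other point is the choice of constants. With z = |u|^2, C = 6 R0^2 and k = delta / 4 the
    inequality reads Phi' <= - k Phi + C z^(p+1). Taking K = 2 C / k makes the right side equal to -
    C z^(p+1) on the boundary Phi = K z^(p+1), whereas |z'| <= 2 sqrt(2 K) z^(1+p/2) there, so K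
    z^(p+1) itself moves at a rate of order z^(p+1+p/2), which is smaller when z is small. The
    kernel of A is what makes the region nonempty: a point of ker A with zero velocity has Phi = 0
    and z > 0. *)

Section HilbertBasics.
Variable H : Hilbert.
Implicit Types x y z : H.

Lemma inner_zero_l x : inner (zero : H) x = 0.
Proof.
transitivity (inner (scal 0 (zero : H)) x).
- f_equal. symmetry; exact (scal_zero_l (V := H) zero).
- rewrite inner_scal_l; apply Rmult_0_l.
Qed.

Lemma inner_opp_l x y : inner (opp x) y = - inner x y.
Proof.
transitivity (inner (scal (- (1)) x) y).
- f_equal. symmetry; exact (scal_opp_one (V := H) x).
- rewrite inner_scal_l; ring.
Qed.

Lemma inner_minus_l x y z : inner (minus x y) z = inner x z - inner y z.
Proof. unfold minus; rewrite inner_plus_l inner_opp_l; ring. Qed.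

Lemma inner_plus_r x y z : inner x (plus y z) = inner x y + inner x z.
Proof. rewrite inner_sym inner_plus_l (inner_sym y) (inner_sym z); ring. Qed.

Lemma inner_scal_r k x y : inner x (scal k y) = k * inner x y.
Proof. now rewrite inner_sym inner_scal_l inner_sym. Qed.

Lemma inner_zero_r x : inner x (zero : H) = 0.
Proof. now rewrite inner_sym inner_zero_l. Qed.

Lemma inner_opp_r x y : inner x (opp y) = - inner x y.
Proof. now rewrite inner_sym inner_opp_l inner_sym. Qed.

Lemma inner_minus_r x y z : inner x (minus y z) = inner x y - inner x z.
Proof. rewrite inner_sym inner_minus_l (inner_sym y) (inner_sym z); ring. Qed.

Lemma inner_ext x y : (forall z, inner x z = inner y z) -> x = y.
Proof.
intro h.
assert (e : minus x y = zero).
{ apply (norm_eq_zero (V := H)).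
  assert (h0 : norm (minus x y) ^ 2 = 0)
    by (rewrite -inner_norm inner_minus_l (h (minus x y)); ring).
  pose proof (norm_ge_0 (minus x y)); nra. }
apply (plus_reg_r (G := H) (opp y)). rewrite plus_opp_r; exact e.
Qed.

Lemma inner_Cauchy_Schwarz x y : Rabs (inner x y) <= norm x * norm y.
Proof.
pose proof (norm_ge_0 x) as hx. pose proof (norm_ge_0 y) as hy.
destruct (Req_dec (norm y) 0) as [h|h].
- rewrite (norm_eq_zero _ h) inner_zero_r Rabs_R0 norm_zero; lra.
(* The component of x orthogonal to y, multiplied by |y|^2 to avoid a division. *)
- set (v := minus (scal (norm y ^ 2) x) (scal (inner x y) y)).
  assert (e : norm v ^ 2 = norm y ^ 2 * ((norm x * norm y) ^ 2 - inner x y ^ 2)).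
  { rewrite -inner_norm; unfold v.
    rewrite !inner_minus_l !inner_minus_r !inner_scal_l !inner_scal_r
      !inner_norm (inner_sym y x); ring. }
  pose proof (pow2_ge_0 (norm v)).
  assert (0 < norm y ^ 2) by (apply pow_lt; lra).
  assert (0 <= (norm x * norm y) ^ 2 - inner x y ^ 2) by nra.
  apply Rsqr_incr_0_var; [|nra].
  rewrite -Rsqr_abs; unfold Rsqr; nra.
Qed.

Lemma inner_le x y : inner x y <= norm x * norm y.
Proof.
eapply Rle_trans; [apply Rle_abs | apply inner_Cauchy_Schwarz].
Qed.

Lemma norm_minus_sym x y : norm (minus x y) = norm (minus y x).
Proof. now rewrite -(norm_opp (minus x y)) opp_minus. Qed.

Lemma norm_minus_le x y : norm (minus x y) <= norm x + norm y.
Proof.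
rewrite -(norm_opp (V := H) y). apply (norm_triangle (V := H) x (opp y)).
Qed.

Lemma norm_sq_plus x y : norm (plus x y) ^ 2 = norm x ^ 2 + 2 * inner x y + norm y ^ 2.
Proof.
rewrite -!inner_norm inner_plus_l !inner_plus_r (inner_sym y x); ring.
Qed.

Lemma norm_sq_minus x y : norm (minus x y) ^ 2 = norm x ^ 2 - 2 * inner x y + norm y ^ 2.
Proof.
rewrite -!inner_norm inner_minus_l !inner_minus_r (inner_sym y x); ring.
Qed.

(** The axiom for the norm is only an inequality; equality comes from the inner product. *)
Lemma norm_scal_R (k : R) x : norm (scal k x) = Rabs k * norm x.
Proof.
apply Rsqr_inj.
- apply norm_ge_0.
- apply Rmult_le_pos; [apply Rabs_pos | apply norm_ge_0].
- rewrite !Rsqr_pow2 -inner_norm inner_scal_l inner_scal_r inner_norm.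
  rewrite Rpow_mult_distr pow2_abs; ring.
Qed.

Lemma filterlim_norm_iff {T : Type} {F : (T -> Prop) -> Prop} {FF : Filter F}
  (f : T -> H) y :
  filterlim f F (locally y) <->
  forall eps, 0 < eps -> F (fun t => norm (minus (f t) y) < eps).
Proof.
rewrite (filterlim_locally_ball_norm (F := F)). split.
- intros h eps heps. exact (h (mkposreal eps heps)).
- intros h eps. exact (h eps (cond_pos eps)).
Qed.

Section Limits.
Context {T : Type} {F : (T -> Prop) -> Prop} {FF : Filter F}.

Lemma filterlim_vplus (f g : T -> H) x y :
  filterlim f F (locally x) -> filterlim g F (locally y) ->
  filterlim (fun t => plus (f t) (g t)) F (locally (plus x y)).
Proof.
intros hf hg.
exact (filterlim_comp_2 f g plus hf hg (filterlim_plus (V := H) x y)).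
Qed.

Lemma filterlim_vopp (f : T -> H) x :
  filterlim f F (locally x) -> filterlim (fun t => opp (f t)) F (locally (opp x)).
Proof. intros hf. exact (filterlim_comp _ _ _ f opp _ _ _ hf (filterlim_opp (V := H) x)). Qed.

Lemma filterlim_vminus (f g : T -> H) x y :
  filterlim f F (locally x) -> filterlim g F (locally y) ->
  filterlim (fun t => minus (f t) (g t)) F (locally (minus x y)).
Proof. intros hf hg. now apply filterlim_vplus, filterlim_vopp. Qed.

(** Polarization reduces joint continuity of the inner product to continuity of the norm. *)
Lemma filterlim_inner (f g : T -> H) x y :
  filterlim f F (locally x) -> filterlim g F (locally y) ->
  filterlim (fun t => inner (f t) (g t)) F (locally (inner x y)).
Proof.
intros hf hg.
assert (e : forall a b : H, inner a b = / 2 * (norm (plus a b) ^ 2 - norm a ^ 2 - norm b ^ 2)).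
{ intros a b; rewrite norm_sq_plus; lra. }
assert (hn : forall (k : T -> H) z, filterlim k F (locally z) ->
   filterlim (fun t => norm (k t)) F (locally (norm z))).
{ intros k z hk. exact (filterlim_comp _ _ _ k norm _ _ _ hk (filterlim_norm (V := H) z)). }
pose proof (hn _ _ (filterlim_vplus _ _ _ _ hf hg)) as h1.
pose proof (hn _ _ hf) as h2. pose proof (hn _ _ hg) as h3.
rewrite e. apply filterlim_ext with (1 := fun t => eq_sym (e (f t) (g t))).
refine (filterlim_comp _ _ _ (fun t => (norm (plus (f t) (g t)), (norm (f t), norm (g t))))
  (fun q : R * (R * R) => / 2 * (fst q ^ 2 - fst (snd q) ^ 2 - snd (snd q) ^ 2))
  F (locally (norm (plus x y), (norm x, norm y))) _ _ _).
- apply filterlim_locally. intro eps.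
  pose proof (proj1 (filterlim_locally _ _) h1 eps) as k1.
  pose proof (proj1 (filterlim_locally _ _) h2 eps) as k2.
  pose proof (proj1 (filterlim_locally _ _) h3 eps) as k3.
  generalize (filter_and _ _ k1 (filter_and _ _ k2 k3)); apply filter_imp.
  intros t [a [b c]]. repeat split; assumption.
- generalize (norm (plus x y)) (norm x) (norm y); intros a b c.
  assert (hsq : forall (k : R * (R * R) -> R) q, continuous k q ->
     continuous (fun q => k q ^ 2) q).
  { intros k q hk. apply (continuous_ext (fun q => k q * (k q * 1))); [intro; simpl; ring|].
    apply (continuous_mult k (fun q => k q * 1)); [exact hk|].
    apply (continuous_mult k (fun _ => 1)); [exact hk | apply continuous_const]. }
  change (continuous (fun q : R * (R * R) =>
    / 2 * (fst q ^ 2 - fst (snd q) ^ 2 - snd (snd q) ^ 2)) (a, (b, c))).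
  apply (continuous_mult (fun _ => / 2)); [apply continuous_const|].
  apply (continuous_minus (V := R_NormedModule)); [apply (continuous_minus (V := R_NormedModule))|];
    apply hsq.
  + apply continuous_fst.
  + apply (continuous_comp snd fst); [apply continuous_snd | apply continuous_fst].
  + apply (continuous_comp snd snd); apply continuous_snd.
Qed.

End Limits.

End HilbertBasics.

(* Linear identities between vectors become ring identities after pairing with an
   arbitrary vector. *)
Ltac vec := apply inner_ext; let z := fresh "z" in intro z;
  rewrite ?(inner_plus_l, inner_minus_l, inner_opp_l, inner_scal_l, inner_zero_l).

(** * One-sided derivatives and a barrier argument *)

(** The supremum of the s such that P holds on [0, s] is reached by the limit clause and passed by
    the step clause, so it cannot be finite. *)
Lemma real_induction (P : R -> Prop) :
  P 0 ->
  (forall t, 0 <= t -> P t -> exists d, 0 < d /\ forall s, t < s < t + d -> P s) ->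
  (forall t, 0 < t -> (forall s, 0 <= s < t -> P s) -> P t) ->
  forall t, 0 <= t -> P t.
Proof.
intros h0 hstep hlim t0 ht0.
destruct (Classical_Prop.classic (P t0)) as [|hn]; [assumption|exfalso].
set (S := fun s => 0 <= s /\ forall r, 0 <= r <= s -> P r).
destruct (completeness S) as [T [hub hlub]].
- exists t0; intros s [hs hs']. destruct (Rle_lt_dec s t0); [assumption|].
  exfalso; apply hn, hs'; lra.
- exists 0; split; [lra|]. intros r hr; replace r with 0 by lra; exact h0.
- assert (hT : 0 <= T).
  { apply hub; split; [lra|]. intros r hr; replace r with 0 by lra; exact h0. }
  assert (hbelow : forall s, 0 <= s < T -> P s).
  { intros s hs. destruct (Classical_Prop.classic (P s)) as [|hps]; [assumption|exfalso].
    assert (T <= s); [apply hlub; intros r [hr hr'] | lra].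
    destruct (Rle_lt_dec r s); [assumption|]. exfalso; apply hps, hr'; lra. }
  assert (hPT : P T).
  { destruct (Rle_lt_or_eq_dec _ _ hT) as [h|h]; [now apply hlim | now rewrite -h]. }
  destruct (hstep T hT hPT) as [d [hd hd']].
  assert (T + d / 2 <= T); [apply hub; split; [lra|] | lra].
  intros r hr. destruct (Rlt_le_dec r T); [apply hbelow; lra|].
  destruct (Req_dec r T) as [->|]; [assumption | apply hd'; lra].
Qed.

Lemma continuous_R_eps (f : R -> R) (t eps : R) :
  continuous f t -> 0 < eps ->
  exists d, 0 < d /\ forall s, Rabs (s - t) < d -> Rabs (f s - f t) < eps.
Proof.
intros h heps.
destruct (proj1 (filterlim_locally _ _) h (mkposreal eps heps)) as [d hd].
exists d; split; [apply cond_pos|]. intros s hs. exact (hd s hs).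
Qed.

Lemma at_right_intro (P : R -> Prop) (x : R) :
  at_right x P <-> exists d, 0 < d /\ forall s, x < s < x + d -> P s.
Proof.
split.
- intros [d hd]. exists d; split; [apply cond_pos|]. intros s hs.
  apply hd; [|lra]. change (Rabs (s - x) < d). apply Rabs_def1; lra.
- intros [d [hd h]]. exists (mkposreal d hd). intros s hs hs'.
  change (Rabs (s - x) < d) in hs. apply Rabs_def2 in hs. apply h; lra.
Qed.

(** A mean value inequality from right increments alone: the local hypothesis carries the bound past
    t, continuity carries it to limits from the left. *)
Lemma right_slope_ge (f : R -> R) (b c : R) :
  (forall t, continuous f t) -> 0 <= b ->
  (forall t, 0 <= t -> exists d, 0 < d /\ forall h, 0 < h < d -> c * h <= f (t + h) - f t) ->
  c * b <= f b - f 0.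
Proof.
intros hc hb hd. revert b hb. apply real_induction.
- lra.
- intros t ht hP. destruct (hd t ht) as [d [hd0 h]].
  exists d; split; [assumption|]. intros s hs.
  specialize (h (s - t)). replace (t + (s - t)) with s in h by ring. lra.
- intros t ht hP.
  apply Rnot_lt_le; intro hlt.
  set (g := fun s => f s - c * s).
  assert (hg : continuous g t).
  { apply (continuous_minus (V := R_NormedModule)); [apply hc|].
    apply (continuous_mult (fun _ => c) (fun s => s));
      [apply continuous_const | apply continuous_id]. }
  destruct (continuous_R_eps g t (f 0 + c * t - f t)) as [d [hd0 h]]; [assumption|lra|].
  set (s := Rmax 0 (t - d / 2)).
  assert (hs : 0 <= s < t).
  { unfold s; split; [apply Rmax_l | apply Rmax_lub_lt; lra]. }
  specialize (hP s hs). specialize (h s). unfold g in h.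
  assert (hs' : Rabs (s - t) < d).
  { assert (t - d / 2 <= s) by apply Rmax_r. apply Rabs_def1; lra. }
  apply h in hs'. apply Rabs_def2 in hs'. lra.
Qed.

(** One-sided because the semigroup acts for nonnegative times: [U (t + h)] is compared with
    [E h (U t)] for h > 0 only. *)
Definition right_deriv (f : R -> R) (t l : R) : Prop :=
  filterlim (fun h => (f (t + h) - f t) / h) (at_right 0) (locally l).

Lemma right_deriv_slope_ge (f : R -> R) (t l c : R) :
  right_deriv f t l -> c < l ->
  exists d, 0 < d /\ forall h, 0 < h < d -> c * h <= f (t + h) - f t.
Proof.
intros h hc.
assert (he : 0 < l - c) by lra.
pose proof (proj1 (filterlim_locally _ _) h (mkposreal _ he)) as h1.
apply at_right_intro in h1. destruct h1 as [d [hd h1]].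
exists d; split; [assumption|]. intros s hs.
specialize (h1 s). rewrite Rplus_0_l in h1. specialize (h1 hs).
change (Rabs ((f (t + s) - f t) / s - l) < l - c) in h1.
apply Rabs_def2 in h1.
assert (hm : c < (f (t + s) - f t) / s) by lra.
apply (Rmult_lt_compat_r s) in hm; [|lra].
unfold Rdiv in hm. rewrite Rmult_assoc Rinv_l in hm; lra.
Qed.

Lemma right_deriv_opp (f : R -> R) (t l : R) :
  right_deriv f t l -> right_deriv (fun s => - f s) t (- l).
Proof.
intro h. unfold right_deriv.
apply (filterlim_ext (fun s => opp ((f (t + s) - f t) / s))).
- intro s. change (- ((f (t + s) - f t) / s) = (- f (t + s) - - f t) / s).
  unfold Rdiv; ring.
- exact (filterlim_comp _ _ _ _ opp _ _ _ h (filterlim_opp (V := R_NormedModule) l)).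
Qed.

Lemma right_deriv_minus (a b : R -> R) t la lb :
  right_deriv a t la -> right_deriv b t lb -> right_deriv (fun s => a s - b s) t (la - lb).
Proof.
intros ha hb. unfold right_deriv.
apply (filterlim_ext (fun h => plus ((a (t + h) - a t) / h) (opp ((b (t + h) - b t) / h)))).
- intro h. change ((a (t + h) - a t) / h + - ((b (t + h) - b t) / h) =
    (a (t + h) - b (t + h) - (a t - b t)) / h). unfold Rdiv; ring.
- refine (filterlim_comp_2 _ _ plus ha _ (filterlim_plus (V := R_NormedModule) _ _)).
  exact (filterlim_comp _ _ _ _ opp _ _ _ hb (filterlim_opp (V := R_NormedModule) lb)).
Qed.

Lemma right_shift_lim {U : UniformSpace} (f : R -> U) t :
  continuous f t -> filterlim (fun h => f (t + h)) (at_right 0) (locally (f t)).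
Proof.
intro h. refine (filterlim_comp _ _ _ (fun h => t + h) f _ _ _ _ h).
intros P [d hP]. exists d. intros s hs hs0. apply hP.
change (Rabs (s - 0) < d) in hs. change (Rabs (t + s - t) < d).
now replace (t + s - t) with (s - 0) by ring.
Qed.

Lemma right_deriv_zero_const (f : R -> R) :
  (forall t, continuous f t) -> (forall t, 0 <= t -> right_deriv f t 0) ->
  forall t, 0 <= t -> f t = f 0.
Proof.
intros hc hd t ht.
assert (hge : forall g : R -> R, (forall t, continuous g t) ->
  (forall t, 0 <= t -> right_deriv g t 0) -> g 0 <= g t).
{ intros g hgc hgd. apply Rnot_lt_le; intro hlt.
  (* A negative slope, so steep at most that [c * t] stays strictly above [g t - g 0]. *)
  set (c := - (g 0 - g t) / (2 * (t + 1))).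
  assert (hc0 : c < 0).
  { unfold c, Rdiv. assert (0 < / (2 * (t + 1))) by (apply Rinv_0_lt_compat; lra). nra. }
  assert (h : c * t <= g t - g 0).
  { apply right_slope_ge; [assumption|assumption|].
    intros s hs. exact (right_deriv_slope_ge _ _ _ _ (hgd s hs) hc0). }
  assert (hcm : c * (2 * (t + 1)) = - (g 0 - g t)) by (unfold c; field; lra).
  nra. }
apply Rle_antisym; [|now apply hge].
apply Ropp_le_cancel. apply (hge (fun s => - f s)).
- intro s. exact (continuous_opp (V := R_NormedModule) f s (hc s)).
- intros s hs. rewrite -Ropp_0. apply right_deriv_opp, hd, hs.
Qed.

Lemma is_derive_right_deriv (f : R -> R) (t l : R) :
  is_derive f t l -> right_deriv f t l.
Proof.
intro h. apply is_derive_Reals in h.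
apply (filterlim_locally (U := R_UniformSpace)). intro eps.
destruct (h eps (cond_pos eps)) as [d hd].
apply at_right_intro. exists d; split; [apply cond_pos|]. intros s hs.
apply (hd s); [lra | rewrite Rabs_right; lra].
Qed.

(** Subtracting a primitive of g leaves a continuous function with right derivative 0, hence a
    constant. This turns the one-sided information given by the semigroup into ordinary
    derivatives. *)
Lemma right_deriv_is_derive (f g : R -> R) :
  (forall t, continuous f t) -> (forall t, continuous g t) ->
  (forall t, 0 <= t -> right_deriv f t (g t)) ->
  forall t, 0 < t -> is_derive f t (g t).
Proof.
intros hf hg hd t ht.
assert (hex : forall a b, ex_RInt g a b)
  by (intros; apply (ex_RInt_continuous (V := R_CompleteNormedModule)); intros; apply hg).
set (G := fun s => RInt g 0 s).
assert (hG : forall s, is_derive G s (g s)).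
{ intro s. apply (is_derive_RInt (V := R_NormedModule) g G 0 s); [|apply hg].
  apply filter_forall; intro r. apply (RInt_correct (V := R_CompleteNormedModule)), hex. }
assert (hGc : forall s, continuous G s).
{ intro s. apply (ex_derive_continuous (V := R_NormedModule)). exists (g s); apply hG. }
assert (hconst : forall s, 0 <= s -> f s - G s = f 0 - G 0).
{ apply (right_deriv_zero_const (fun s => f s - G s)).
  - intro s. exact (continuous_minus (V := R_NormedModule) f G s (hf s) (hGc s)).
  - intros s hs. rewrite -(Rminus_diag (g s)).
    apply right_deriv_minus; [now apply hd | apply is_derive_right_deriv, hG]. }
apply (is_derive_ext_loc (fun s => plus (G s) (f 0 - G 0))).
- exists (mkposreal t ht). intros s hs. change (Rabs (s - t) < t) in hs.
  apply Rabs_def2 in hs. change (G s + (f 0 - G 0) = f s).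
  rewrite -(hconst s); [ring | lra].
- replace (g t) with (plus (g t) 0) by (change (g t + 0 = g t); ring).
  apply (is_derive_plus (V := R_NormedModule) G (fun _ => f 0 - G 0)); [apply hG|].
  apply (is_derive_const (V := R_NormedModule)).
Qed.

Lemma nonincreasing_of_derive (f f' : R -> R) :
  (forall t, continuous f t) ->
  (forall t, 0 < t -> is_derive f t (f' t)) -> (forall t, 0 < t -> f' t <= 0) ->
  forall t, 0 <= t -> f t <= f 0.
Proof.
intros hc hd hn t ht.
destruct (Req_dec t 0) as [->|hne]; [lra|].
(* [MVT_gen] may return the endpoint 0, where nothing is known about [f']. *)
destruct (MVT_gen f 0 t (fun x => if Rle_dec x 0 then Rmin 0 (f' x) else f' x)) as [c [hc1 hc2]].
- intros x hx. rewrite Rmin_left in hx; [|lra].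
  destruct (Rle_dec x 0); [lra | apply hd; lra].
- intros x _. apply continuity_pt_filterlim, hc.
- rewrite Rmin_left in hc1; [|lra].
  destruct (Rle_dec c 0).
  + assert (Rmin 0 (f' c) <= 0) by apply Rmin_l. nra.
  + assert (f' c <= 0) by (apply hn; lra). nra.
Qed.

Lemma is_derive_Rpower_comp (z : R -> R) (t l q : R) :
  is_derive z t l -> 0 < z t ->
  is_derive (fun s => Rpower (z s) q) t (q * Rpower (z t) (q - 1) * l).
Proof.
intros hz h.
replace (q * Rpower (z t) (q - 1) * l) with (scal l (q * Rpower (z t) (q - 1)))
  by (change (l * (q * Rpower (z t) (q - 1)) = q * Rpower (z t) (q - 1) * l); ring).
apply (is_derive_comp (fun x => Rpower x q) z t); [|exact hz].
apply is_derive_Reals, derivable_pt_lim_power, h.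
Qed.

Lemma continuous_Rpower_comp (z : R -> R) (t q : R) :
  continuous z t -> 0 < z t -> continuous (fun s => Rpower (z s) q) t.
Proof.
intros hz h. apply (continuous_comp z (fun x => Rpower x q)); [exact hz|].
apply (ex_derive_continuous (V := R_NormedModule)). exists (q * Rpower (z t) (q - 1)).
apply is_derive_Reals, derivable_pt_lim_power, h.
Qed.

Lemma Rpower_pos (x y : R) : 0 < Rpower x y.
Proof. apply exp_pos. Qed.

(** With z = |u|^2 this is the bound on |z'| / 2 when Phi = K z^(p+1). *)
Lemma Rpower_half_sqrt (K z p : R) : 0 < K -> 0 < z ->
  sqrt z * sqrt (2 * (K * Rpower z (p + 1))) = sqrt (2 * K) * Rpower z (1 + p / 2).
Proof.
intros hK hz.
rewrite -Rmult_assoc sqrt_mult_alt; [|lra].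
rewrite -(Rpower_sqrt z hz) -(Rpower_sqrt (Rpower z (p + 1)) (Rpower_pos _ _)).
rewrite Rpower_mult.
replace (1 + p / 2) with (/ 2 + (p + 1) * / 2) by field.
rewrite Rpower_plus; ring.
Qed.

(** * An invariant region for a scalar differential inequality *)

Section Barrier.
(** In the application z = |u|^2, Phi is the corrected energy, and e is the threshold [ez] for z
    below which the differential inequality is available. *)
Variables (Phi Phi' z z' : R -> R) (p k C K e : R).
Hypotheses (hp : 0 < p) (hk : 0 < k) (hC : 0 < C) (he : 0 < e) (hK : K = 2 * C / k).
Hypothesis (hsmall : 2 * K * (p + 1) * sqrt (2 * K) * Rpower e (p / 2) < C).
Hypotheses (cPhi : forall t, continuous Phi t) (cz : forall t, continuous z t).
Hypotheses (dPhi : forall t, 0 < t -> is_derive Phi t (Phi' t))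
  (dz : forall t, 0 < t -> is_derive z t (z' t)).
Hypothesis (hz' : forall t, 0 < t -> Rabs (z' t) <= 2 * (sqrt (z t) * sqrt (2 * Phi t))).
Hypothesis (hPhi' : forall t, 0 < t -> 0 < z t <= e ->
  Phi' t <= - k * Phi t + C * Rpower (z t) (p + 1)).
Hypothesis (hPhi_e : forall t, 0 <= t -> Phi t < K * Rpower e (p + 1)).
Hypotheses (hz0 : 0 < z 0) (hPhi0 : Phi 0 < K * Rpower (z 0) (p + 1)).

(** Positivity of z is carried along because [Rpower] takes the value 1 at a nonpositive base. *)
Let good t := 0 < z t /\ Phi t < K * Rpower (z t) (p + 1).

Lemma barrier_K_pos : 0 < K.
Proof. rewrite hK. apply Rdiv_lt_0_compat; lra. Qed.

Lemma barrier_z'_bound t : 0 < t -> 0 < z t -> Phi t <= K * Rpower (z t) (p + 1) ->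
  Rabs (z' t) <= 2 * (sqrt (2 * K) * Rpower (z t) (1 + p / 2)).
Proof.
intros ht hzt hP. eapply Rle_trans; [now apply hz'|].
rewrite -Rpower_half_sqrt; [|apply barrier_K_pos | assumption].
apply Rmult_le_compat_l; [lra|].
apply Rmult_le_compat_l; [apply sqrt_pos|].
apply sqrt_le_1_alt. lra.
Qed.

(** The derivative of z^(-p/2) is bounded because the powers cancel: z^(-p/2-1) times the bound
    z^(1+p/2) for z' is 1. *)
Lemma barrier_lower t : 0 <= t -> (forall s, 0 <= s <= t -> good s) ->
  Rpower (z t) (- p / 2) <= Rpower (z 0) (- p / 2) + p * sqrt (2 * K) * t.
Proof.
intros ht hg.
destruct (Req_dec t 0) as [->|hne]; [lra|].
(* The intermediate point may be the endpoint 0, where nothing is known about [z']; the value 0 put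
   there satisfies the desired bound trivially. *)
destruct (MVT_gen (fun s => Rpower (z s) (- p / 2)) 0 t
  (fun s => if Rle_dec s 0 then 0 else
    (- p / 2) * Rpower (z s) (- p / 2 - 1) * z' s)) as [c [hc1 hc2]].
- intros s hs. rewrite Rmin_left in hs; [|lra]. rewrite Rmax_right in hs; [|lra].
  destruct (Rle_dec s 0); [lra|].
  apply is_derive_Rpower_comp; [apply dz; lra | apply hg; lra].
- intros s hs. rewrite Rmin_left in hs; [|lra]. rewrite Rmax_right in hs; [|lra].
  apply continuity_pt_filterlim. apply continuous_Rpower_comp; [apply cz | apply hg; lra].
- rewrite Rmin_left in hc1; [|lra]. rewrite Rmax_right in hc1; [|lra].
  assert (hs : 0 <= sqrt (2 * K)) by apply sqrt_pos.
  destruct (Rle_dec c 0).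
  + assert (0 <= p * sqrt (2 * K) * t) by (apply Rmult_le_pos; nra). lra.
  + destruct (hg c) as [hzc hPc]; [lra|].
    pose proof (barrier_z'_bound c ltac:(lra) hzc ltac:(lra)) as hb.
    assert (hd : (- p / 2) * Rpower (z c) (- p / 2 - 1) * z' c <= p * sqrt (2 * K)).
    { replace (p * sqrt (2 * K)) with
        (p / 2 * (Rpower (z c) (- p / 2 - 1) * (2 * (sqrt (2 * K) * Rpower (z c) (1 + p / 2))))).
      - replace (- p / 2 * Rpower (z c) (- p / 2 - 1) * z' c) with
          (p / 2 * (Rpower (z c) (- p / 2 - 1) * - z' c)) by field.
        apply Rmult_le_compat_l; [lra|].
        apply Rmult_le_compat_l; [apply Rlt_le, Rpower_pos|].
        apply Rabs_le_between in hb. lra.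
      - replace (Rpower (z c) (- p / 2 - 1) * (2 * (sqrt (2 * K) * Rpower (z c) (1 + p / 2))))
          with (2 * sqrt (2 * K) * (Rpower (z c) (- p / 2 - 1) * Rpower (z c) (1 + p / 2))) by ring.
        rewrite -Rpower_plus. replace (- p / 2 - 1 + (1 + p / 2)) with 0 by field.
        rewrite Rpower_O; [field|assumption]. }
    rewrite Rminus_0_r in hc2. nra.
Qed.

Lemma barrier_good t : 0 <= t -> good t.
Proof.
pose proof barrier_K_pos as hK0.
assert (cTheta : forall t, 0 < z t ->
  continuous (fun s => Phi s - K * Rpower (z s) (p + 1)) t).
{ intros s hs. apply (continuous_minus (V := R_NormedModule)); [apply cPhi|].
  apply (continuous_mult (fun _ => K)); [apply continuous_const|].
  now apply continuous_Rpower_comp; [apply cz|]. }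
revert t. apply real_induction.
- now split.
- intros t ht [h1 h2].
  destruct (continuous_R_eps z t (z t) (cz t) h1) as [d1 [hd1 h1']].
  destruct (continuous_R_eps _ t (K * Rpower (z t) (p + 1) - Phi t) (cTheta t h1))
    as [d2 [hd2 h2']]; [lra|].
  exists (Rmin d1 d2). split; [now apply Rmin_glb_lt|]. intros s hs.
  assert (Rmin d1 d2 <= d1) by apply Rmin_l. assert (Rmin d1 d2 <= d2) by apply Rmin_r.
  assert (hs1 : Rabs (s - t) < d1) by (apply Rabs_def1; lra).
  assert (hs2 : Rabs (s - t) < d2) by (apply Rabs_def1; lra).
  apply h1' in hs1. apply h2' in hs2.
  apply Rabs_def2 in hs1. apply Rabs_def2 in hs2. split; lra.
- intros T hT hg.
  (* On [0, T) the previous lemma gives z^(-p/2) <= Y, that is z >= Y^(-2/p) = m, so z cannot vanish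
     at T. *)
  set (Y := Rpower (z 0) (- p / 2) + p * sqrt (2 * K) * T).
  assert (hY : 0 < Y).
  { pose proof (Rpower_pos (z 0) (- p / 2)).
    assert (0 <= p * sqrt (2 * K) * T); [|unfold Y; lra].
    apply Rmult_le_pos; [|lra]. apply Rmult_le_pos; [lra | apply sqrt_pos]. }
  set (m := Rpower Y (- 2 / p)).
  assert (hm : 0 < m) by apply Rpower_pos.
  assert (hzm : forall s, 0 <= s < T -> m <= z s).
  { intros s hs. destruct (hg s hs) as [hzs _].
    assert (hy : Rpower (z s) (- p / 2) <= Y).
    { eapply Rle_trans; [apply barrier_lower; [lra|] |].
      - intros r hr; apply hg; lra.
      - apply Rplus_le_compat_l, Rmult_le_compat_l; [|lra].
        apply Rmult_le_pos; [lra | apply sqrt_pos]. }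
    apply Rnot_lt_le; intro hlt.
    assert (h : Rpower m (- p / 2) = Y).
    { unfold m. rewrite Rpower_mult. replace (- 2 / p * (- p / 2)) with 1 by (field; lra).
      now apply Rpower_1. }
    assert (Rpower m (- p / 2) < Rpower (z s) (- p / 2)); [|lra].
    unfold Rpower. apply exp_increasing.
    assert (ln (z s) < ln m) by (apply ln_increasing; lra). nra. }
  assert (hzT : m <= z T).
  { apply Rnot_lt_le; intro hlt.
    destruct (continuous_R_eps z T (m - z T) (cz T)) as [d [hd h]]; [lra|].
    set (s := Rmax 0 (T - d / 2)).
    assert (hs : 0 <= s < T) by (unfold s; split; [apply Rmax_l | apply Rmax_lub_lt; lra]).
    assert (hs' : Rabs (s - T) < d).
    { assert (T - d / 2 <= s) by apply Rmax_r. apply Rabs_def1; lra. }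
    apply h, Rabs_def2 in hs'. specialize (hzm s hs). lra. }
  split; [lra|]. apply Rnot_le_lt; intro hbad.
  assert (hzTpos : 0 < z T) by lra.
  (* If the strict bound fails at T, continuity from the left forces equality. *)
  assert (hTh : Phi T - K * Rpower (z T) (p + 1) = 0).
  { apply Rle_antisym; [|lra]. apply Rnot_lt_le; intro hlt.
    destruct (continuous_R_eps _ T _ (cTheta T hzTpos) hlt) as [d [hd h]].
    set (s := Rmax 0 (T - d / 2)).
    assert (hs : 0 <= s < T) by (unfold s; split; [apply Rmax_l | apply Rmax_lub_lt; lra]).
    assert (hs' : Rabs (s - T) < d).
    { assert (T - d / 2 <= s) by apply Rmax_r. apply Rabs_def1; lra. }
    apply h, Rabs_def2 in hs'. destruct (hg s hs). lra. }
  (* For z T >= e the bound [hPhi_e] would already be strict at T, so the differential inequality is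
     only needed below e. *)
  assert (hze : z T < e).
  { apply Rnot_le_lt; intro hle.
    assert (Rpower e (p + 1) <= Rpower (z T) (p + 1)) by (apply Rle_Rpower_l; lra).
    specialize (hPhi_e T ltac:(lra)). nra. }
  set (D := Phi' T - K * ((p + 1) * Rpower (z T) (p + 1 - 1) * z' T)).
  assert (hD : is_derive (fun s => Phi s - K * Rpower (z s) (p + 1)) T D).
  { apply (is_derive_minus (V := R_NormedModule)); [now apply dPhi|].
    apply (is_derive_scal (fun s => Rpower (z s) (p + 1))).
    now apply is_derive_Rpower_comp; [apply dz|]. }
  (* Here w = z^(p+1). Since k K = 2 C, equality at T gives Phi' <= - C w, and [hsmall] keeps the
     variation of K z^(p+1) strictly below C w. *)
  assert (hDneg : D < 0).
  { pose proof (hPhi' T hT ltac:(lra)) as h1.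
    pose proof (barrier_z'_bound T hT hzTpos ltac:(lra)) as h2.
    apply Rabs_le_between in h2.
    set (w := Rpower (z T) (p + 1)) in *.
    assert (hw : 0 < w) by apply Rpower_pos.
    assert (hprod : Rpower (z T) (p + 1 - 1) * Rpower (z T) (1 + p / 2) =
       w * Rpower (z T) (p / 2)).
    { unfold w; rewrite -!Rpower_plus; f_equal; field. }
    assert (hq : Rpower (z T) (p / 2) <= Rpower e (p / 2)) by (apply Rle_Rpower_l; lra).
    set (q := Rpower (z T) (p / 2)) in *. set (a := Rpower (z T) (p + 1 - 1)) in *.
    assert (ha : 0 < a) by apply Rpower_pos.
    set (b := Rpower (z T) (1 + p / 2)) in *.
    set (S := sqrt (2 * K)) in *. assert (hS : 0 <= S) by apply sqrt_pos.
    assert (hkK : k * K = 2 * C) by (rewrite hK; field; lra).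
    assert (hkP : k * Phi T = 2 * C * w).
    { replace (Phi T) with (K * w) by lra. rewrite -Rmult_assoc hkK; ring. }
    assert (hx : - (a * z' T) <= 2 * (S * (w * q))) by (rewrite -hprod; nra).
    assert (hx2 : - (K * ((p + 1) * a * z' T)) <= K * (p + 1) * (2 * (S * (w * q)))).
    { replace (- (K * ((p + 1) * a * z' T))) with (K * (p + 1) * - (a * z' T)) by ring.
      apply Rmult_le_compat_l; [|exact hx]. apply Rmult_le_pos; lra. }
    assert (hx3 : K * (p + 1) * (2 * (S * (w * q))) <= w * (2 * K * (p + 1) * S * Rpower e (p / 2))).
    { replace (K * (p + 1) * (2 * (S * (w * q)))) with (w * (2 * K * (p + 1) * S * q)) by ring.
      apply Rmult_le_compat_l; [lra|]. apply Rmult_le_compat_l; [|exact hq].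
      repeat apply Rmult_le_pos; lra. }
    assert (hx4 : w * (2 * K * (p + 1) * S * Rpower e (p / 2)) < w * C)
      by (apply Rmult_lt_compat_l; assumption).
    unfold D. lra. }
  (* A function vanishing at T with negative derivative is positive just before T, contrary to
     [good] on [0, T). *)
  apply is_derive_Reals in hD.
  destruct (hD (- D) ltac:(lra)) as [d hd].
  set (s := Rmax 0 (T - d / 2)).
  assert (hs : 0 <= s < T).
  { pose proof (cond_pos d). unfold s; split; [apply Rmax_l | apply Rmax_lub_lt; lra]. }
  assert (hs' : T - d / 2 <= s) by apply Rmax_r.
  specialize (hd (s - T) ltac:(lra)).
  pose proof (cond_pos d).
  specialize (hd ltac:(rewrite Rabs_left; lra)).
  replace (T + (s - T)) with s in hd by ring.
  rewrite hTh Rminus_0_r in hd.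
  apply Rabs_def2 in hd. destruct hd as [hd1 _].
  destruct (hg s hs) as [_ hgs].
  assert (0 < (Phi s - K * Rpower (z s) (p + 1)) / (s - T)); [|lra].
  replace ((Phi s - K * Rpower (z s) (p + 1)) / (s - T)) with
    ((K * Rpower (z s) (p + 1) - Phi s) / (T - s)) by (field; lra).
  apply Rdiv_lt_0_compat; lra.
Qed.

Lemma barrier t : 0 <= t ->
  0 < z t /\ Rpower (z t) (- p / 2) <= Rpower (z 0) (- p / 2) + p * sqrt (2 * K) * t.
Proof.
intro ht. split; [now apply barrier_good|].
apply barrier_lower; [assumption|]. intros s hs; apply barrier_good; lra.
Qed.

End Barrier.

(** * Completeness and orthogonal projection *)

Lemma hilbert_complete (H : Hilbert) (F : (H -> Prop) -> Prop) :
  ProperFilter F ->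
  (forall eps, 0 < eps -> exists x : H, F (fun v => norm (minus v x) < eps)) ->
  exists l : H, forall eps, 0 < eps -> F (fun v => norm (minus v l) < eps).
Proof.
intros PF hF.
assert (hc : cauchy (T := H) F).
{ intro eps. destruct (hF eps (cond_pos eps)) as [x hx]. exists x.
  revert hx; apply filter_imp; intros v hv. exact (norm_compat1 (V := H) x v eps hv). }
pose proof (complete_cauchy (T := H) F PF hc) as hl.
exists (lim (T := H) F). intros eps heps.
(* Norm balls and uniform balls are comparable only up to [norm_factor]. *)
assert (h : 0 < eps / norm_factor (V := H))
  by (apply Rdiv_lt_0_compat; [assumption | apply norm_factor_gt_0]).
generalize (hl (mkposreal _ h)); apply filter_imp; intros v hv.
apply (norm_compat2 (V := H)) in hv. simpl in hv.
replace (norm_factor (V := H) * (eps / norm_factor (V := H))) with eps in hv; [exact hv|].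
field. apply Rgt_not_eq, norm_factor_gt_0.
Qed.

Section Projection.
Variables (H : Hilbert) (K : H -> Prop).
Hypotheses (hK0 : K zero) (hKplus : forall x y, K x -> K y -> K (plus x y))
  (hKscal : forall k x, K x -> K (scal k x)).
Hypothesis (hKclosed : forall x,
  (forall eps, 0 < eps -> exists y, K y /\ norm (minus y x) < eps) -> K x).

Lemma orthogonal_projection_exists (x : H) :
  exists y, K y /\ forall w, K w -> inner (minus x y) w = 0.
Proof.
(* Signs are reversed so that the infimum of the squared distance is obtained from a supremum. *)
set (N := fun r => exists v, K v /\ r = - norm (minus x v) ^ 2).
destruct (completeness N) as [md [hub hlub]].
{ exists 0. intros r [v [_ ->]]. pose proof (pow2_ge_0 (norm (minus x v))). lra. }
{ exists (- norm (minus x zero) ^ 2), zero; now split. }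
set (d := - md).
assert (hd : forall v, K v -> d <= norm (minus x v) ^ 2).
{ intros v hv. assert (- norm (minus x v) ^ 2 <= md) by (apply hub; exists v; now split).
  unfold d; lra. }
assert (hnear : forall eps, 0 < eps -> exists v, K v /\ norm (minus x v) ^ 2 < d + eps).
{ intros eps heps. destruct (classic (exists v, K v /\ norm (minus x v) ^ 2 < d + eps))
    as [|hn]; [assumption|exfalso].
  assert (md <= md - eps); [|lra]. apply hlub. intros r [v [hv ->]].
  destruct (Rlt_le_dec (norm (minus x v) ^ 2) (d + eps)) as [hl|hl].
  - exfalso; apply hn; exists v; now split.
  - unfold d in hl; lra. }
(* The filter generated by the near minimizers replaces a minimizing sequence, so none has to be
   chosen. *)
set (F := fun P : H -> Prop => exists eps, 0 < eps /\
  forall v, K v -> norm (minus x v) ^ 2 < d + eps -> P v).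
assert (PF : ProperFilter F).
{ constructor; [|constructor].
  - intros P [eps [heps h]]. destruct (hnear eps heps) as [v [hv1 hv2]].
    exists v; now apply h.
  - exists 1; split; [lra | auto].
  - intros P Q [e1 [he1 h1]] [e2 [he2 h2]]. exists (Rmin e1 e2); split.
    + now apply Rmin_glb_lt.
    + intros v hv hlt. pose proof (Rmin_l e1 e2). pose proof (Rmin_r e1 e2).
      split; [apply h1 | apply h2]; auto; lra.
  - intros P Q hPQ [e1 [he1 h1]]. exists e1; split; auto. }
assert (FF : Filter F) by apply PF.
destruct (hilbert_complete H F PF) as [l hl].
{ intros eps heps.
  (* For two points of K whose squared distance to x is below d + eps^2 / 4, the parallelogram
     identity and the bound d at their midpoint give |v - v0|^2 < eps^2. *)
  assert (he : 0 < eps ^ 2 / 4) by nra.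
  destruct (hnear _ he) as [v0 [hv0 hv0']]. exists v0, (eps ^ 2 / 4).
  split; [assumption|]. intros v hv hv'.
  assert (hpar : norm (minus v v0) ^ 2 + 4 * norm (minus x (scal (/ 2) (plus v v0))) ^ 2
    = 2 * norm (minus x v) ^ 2 + 2 * norm (minus x v0) ^ 2).
  { rewrite !norm_sq_minus inner_scal_r inner_plus_r.
    rewrite -(inner_norm (scal (/ 2) (plus v v0))) inner_scal_l inner_scal_r inner_norm.
    rewrite norm_sq_plus. field. }
  assert (hm : d <= norm (minus x (scal (/ 2) (plus v v0))) ^ 2)
    by (apply hd, hKscal, hKplus; assumption).
  pose proof (norm_ge_0 (minus v v0)). nra. }
assert (hKl : K l).
{ apply hKclosed. intros eps heps.
  destruct (filter_ex (F := F) (fun v => K v /\ norm (minus v l) < eps)) as [v hv]; [|now exists v].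
  apply filter_and; [|now apply hl]. exists 1; split; [lra | auto]. }
assert (hlim : filterlim (fun v => inner (minus x v) (minus x v)) F
  (locally (inner (minus x l) (minus x l)))).
{ assert (h : filterlim (fun v => minus x v) F (locally (minus x l))).
  { apply (filterlim_vminus (F := F) H); [exact (filterlim_const (U := H) x) | now apply filterlim_norm_iff]. }
  now apply (filterlim_inner (F := F) H). }
assert (hmin : norm (minus x l) ^ 2 = d).
{ apply Rle_antisym; [|now apply hd]. apply Rnot_lt_le; intro hlt.
  rewrite -inner_norm in hlt.
  assert (he : 0 < (inner (minus x l) (minus x l) - d) / 2) by lra.
  pose proof (proj1 (filterlim_locally _ _) hlim (mkposreal _ he)) as h1.
  assert (h2 : F (fun v => norm (minus x v) ^ 2 < d + (inner (minus x l) (minus x l) - d) / 2)).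
  { eexists; split; [exact he | auto]. }
  destruct (filter_ex _ (filter_and _ _ h1 h2)) as [v [hv1 hv2]].
  change (Rabs (inner (minus x v) (minus x v) - inner (minus x l) (minus x l)) <
    (inner (minus x l) (minus x l) - d) / 2) in hv1.
  apply Rabs_def2 in hv1. rewrite -inner_norm in hv2. lra. }
exists l; split; [assumption|]. intros w hw.
set (i := inner (minus x l) w). set (n := norm w ^ 2).
assert (hn : 0 <= n) by apply pow2_ge_0.
assert (hs : forall s, 2 * s * i <= s ^ 2 * n).
{ intro s.
  assert (h : d <= norm (minus x (plus l (scal s w))) ^ 2) by (apply hd, hKplus; auto).
  replace (minus x (plus l (scal s w))) with (minus (minus x l) (scal s w)) in h
    by (vec; ring).
  rewrite norm_sq_minus inner_scal_r hmin in h.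
  rewrite -(inner_norm (scal s w)) inner_scal_l inner_scal_r inner_norm in h.
  fold i n in h. lra. }
(* The minimizer of the quadratic in s would be i / n; the added 1 also covers w = 0 and still
   forces i = 0. *)
specialize (hs (i / (n + 1))).
assert (hi : i ^ 2 * (n + 2) <= 0).
{ apply (Rmult_le_compat_r ((n + 1) ^ 2)) in hs; [|apply pow2_ge_0].
  replace (2 * (i / (n + 1)) * i * (n + 1) ^ 2) with (2 * i ^ 2 * (n + 1)) in hs by (field; lra).
  replace ((i / (n + 1)) ^ 2 * n * (n + 1) ^ 2) with (i ^ 2 * n) in hs by (field; lra).
  lra. }
pose proof (pow2_ge_0 i). nra.
Qed.

End Projection.

(** * The uniform boundedness principle *)

Section UniformBoundedness.
Variable H : Hilbert.

(** [S] is the operator norm, positive by the hypothesis on x. The factor 2/3 has to exceed 1/2, the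
    relative size of the tail in the gliding hump below. *)
Lemma almost_norm_attaining (T : H -> H) (c : R) :
  is_linear T -> 0 <= c -> (exists x, c * norm x < norm (T x)) ->
  exists S u, c <= S /\ (forall y, norm (T y) <= S * norm y) /\
    0 < norm u /\ 2 / 3 * S * norm u <= norm (T u).
Proof.
intros hT hc [x hx].
assert (hpos : forall y : H, y <> zero -> 0 < norm y).
{ intros y hy. destruct (Rle_lt_or_eq_dec _ _ (norm_ge_0 y)) as [|h]; [assumption|].
  exfalso; apply hy, (norm_eq_zero (V := H)); now symmetry. }
assert (hTpos : forall y, 0 < norm (T y) -> 0 < norm y).
{ intros y hy. apply hpos. intros ->. rewrite (linear_zero T hT) in hy.
  rewrite (norm_zero (V := H)) in hy. lra. }
destruct (linear_norm T hT) as [M [hM hTM]].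
set (N := fun r => exists y, 0 < norm y /\ r = norm (T y) / norm y).
assert (hx0 : 0 < norm x).
{ apply hTpos. pose proof (norm_ge_0 x). nra. }
destruct (completeness N) as [S [hub hlub]].
{ exists M. intros r [y [hy ->]]. apply Rle_div_l; [assumption|]. apply hTM. }
{ exists (norm (T x) / norm x), x; now split. }
assert (hcS : c < S).
{ apply Rlt_le_trans with (norm (T x) / norm x).
  - now apply Rlt_div_r.
  - apply hub; exists x; now split. }
assert (hu : exists u, 0 < norm u /\ 2 / 3 * S <= norm (T u) / norm u).
{ destruct (classic (exists u, 0 < norm u /\ 2 / 3 * S <= norm (T u) / norm u)) as [|hn];
    [assumption|exfalso].
  assert (S <= 2 / 3 * S); [|lra]. apply hlub. intros r [y [hy ->]].
  destruct (Rlt_le_dec (norm (T y) / norm y) (2 / 3 * S)); [lra|].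
  exfalso; apply hn; exists y; now split. }
destruct hu as [u [hu1 hu2]].
exists S, u. split; [lra|]. split; [|split; [assumption|]].
- intro y. destruct (Rle_lt_or_eq_dec _ _ (norm_ge_0 y)) as [hy|hy].
  + apply Rle_div_l; [assumption|]. apply hub; exists y; now split.
  + rewrite -hy Rmult_0_r. rewrite (norm_eq_zero (V := H) y (eq_sym hy)).
    rewrite (linear_zero T hT). rewrite (norm_zero (V := H)). lra.
- now apply Rle_div_r.
Qed.

(* Sokal's gliding hump: the n-th summand has norm 3^-n and almost attains the
   norm of T n, so the later ones cannot cancel its contribution. *)
Lemma uniform_boundedness (T : nat -> H -> H) :
  (forall n, is_linear (T n)) ->
  (forall n, exists x, 4 ^ n * norm x < norm (T n x)) ->
  exists x, forall n, (4 / 3) ^ n / 6 <= norm (T n x).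
Proof.
intros hT hbig.
set (P := fun n (v : H) => norm v = (/ 3) ^ n /\
  exists S, 4 ^ n <= S /\ (forall y, norm (T n y) <= S * norm y) /\
    2 / 3 * S * (/ 3) ^ n <= norm (T n v)).
assert (hv : forall n, exists v, P n v).
{ intro n. assert (h4 : 0 <= 4 ^ n) by (apply pow_le; lra).
  destruct (almost_norm_attaining (T n) (4 ^ n) (hT n) h4 (hbig n)) as [S [u [h1 [h2 [h3 h5]]]]].
  assert (h3n : 0 < (/ 3) ^ n) by (apply pow_lt; lra).
  assert (hk : 0 < (/ 3) ^ n / norm u) by (now apply Rdiv_lt_0_compat).
  exists (scal ((/ 3) ^ n / norm u) u). split.
  - rewrite norm_scal_R Rabs_right; [field; lra | lra].
  - exists S; repeat split; [assumption | assumption |].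
    rewrite (linear_scal (T n) (hT n)) norm_scal_R Rabs_right; [|lra].
    apply (Rmult_le_compat_l ((/ 3) ^ n / norm u)) in h5; [|lra].
    replace ((/ 3) ^ n / norm u * (2 / 3 * S * norm u)) with (2 / 3 * S * (/ 3) ^ n) in h5
      by (field; lra). exact h5. }
set (v := fun n => proj1_sig (constructive_indefinite_description _ (hv n))).
assert (hv' : forall n, P n (v n))
  by (intro n; exact (proj2_sig (constructive_indefinite_description _ (hv n)))).
clearbody v.
(* The sign of each summand is chosen so that the hump survives: T (y + v) and T (y - v) differ by 2
   T v, so one of them has norm at least |T v|. *)
set (x := nat_rect (fun _ => H) zero (fun n y =>
  if Rle_dec (norm (T n (v n))) (norm (T n (plus y (v n))))
  then plus y (v n) else minus y (v n))).
assert (hstep : forall n, norm (minus (x (S n)) (x n)) = (/ 3) ^ n).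
{ intro n. rewrite -(proj1 (hv' n)). simpl.
  destruct (Rle_dec _ _).
  - f_equal. vec; ring.
  - rewrite -(norm_opp (V := H) (v n)). f_equal. vec; ring. }
assert (hhump : forall n, norm (T n (v n)) <= norm (T n (x (S n)))).
{ intro n.
  change (x (S n)) with (if Rle_dec (norm (T n (v n))) (norm (T n (plus (x n) (v n))))
    then plus (x n) (v n) else minus (x n) (v n)).
  destruct (Rle_dec _ _) as [h|h]; [assumption|].
  apply Rnot_le_lt in h.
  assert (h2 : scal 2 (T n (v n)) = minus (T n (plus (x n) (v n))) (T n (minus (x n) (v n)))).
  { rewrite linear_minus; [|apply hT]. rewrite (linear_plus (T n) (hT n)). vec; ring. }
  assert (h2' : norm (minus (T n (plus (x n) (v n))) (T n (minus (x n) (v n)))) =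
    2 * norm (T n (v n))) by (rewrite -h2 norm_scal_R Rabs_right; lra).
  pose proof (norm_minus_le H (T n (plus (x n) (v n))) (T n (minus (x n) (v n)))).
  lra. }
assert (htail : forall n k, norm (minus (x (k + n)%nat) (x n)) <= 3 / 2 * ((/ 3) ^ n - (/ 3) ^ (k + n))).
{ intros n k; induction k as [|k IH].
  - simpl. rewrite (minus_eq_zero (G := H)) (norm_zero (V := H)). lra.
  - replace (S k + n)%nat with (S (k + n)) by lia.
    replace (minus (x (S (k + n))) (x n)) with
      (plus (minus (x (S (k + n))) (x (k + n)%nat)) (minus (x (k + n)%nat) (x n))) by (vec; ring).
    eapply Rle_trans; [apply (norm_triangle (V := H))|].
    rewrite hstep. simpl pow. lra. }
assert (hpow : forall eps, 0 < eps -> exists N, forall n, (N <= n)%nat -> 3 / 2 * (/ 3) ^ n < eps).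
{ intros eps heps.
  destruct (pow_lt_1_zero (/ 3) ltac:(rewrite Rabs_right; lra) (eps / 2) ltac:(lra)) as [N hN].
  exists N; intros n hn. specialize (hN n hn).
  rewrite Rabs_right in hN; [|apply Rle_ge, pow_le; lra]. lra. }
set (F := fun P : H -> Prop => eventually (fun n => P (x n))).
assert (PF : ProperFilter F) by exact (filtermap_proper_filter _ _ x eventually eventually_filter).
assert (hle : forall n m, (n <= m)%nat -> norm (minus (x m) (x n)) <= 3 / 2 * (/ 3) ^ n).
{ intros n m hm. replace m with ((m - n) + n)%nat by lia.
  eapply Rle_trans; [apply htail|].
  assert (0 < (/ 3) ^ (m - n + n)) by (apply pow_lt; lra). lra. }
destruct (hilbert_complete H F PF) as [l hl].
{ intros eps heps. destruct (hpow eps heps) as [N hN].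
  exists (x N), N. intros m hm. eapply Rle_lt_trans; [now apply hle | now apply hN]. }
assert (hdist : forall n, norm (minus l (x n)) <= 3 / 2 * (/ 3) ^ n).
{ intro n. apply le_epsilon; intros eps heps.
  destruct (hl eps heps) as [N hN].
  specialize (hN (max N n) (PeanoNat.Nat.le_max_l _ _)).
  pose proof (hle n (max N n) (PeanoNat.Nat.le_max_r _ _)).
  replace (minus l (x n)) with (plus (minus l (x (max N n))) (minus (x (max N n)) (x n)))
    by (vec; ring).
  eapply Rle_trans; [apply (norm_triangle (V := H))|].
  rewrite norm_minus_sym in hN. lra. }
exists l. intro n.
destruct (proj2 (hv' n)) as [S [h1 [h2 h3]]].
pose proof (hhump n) as h4. specialize (hdist (Datatypes.S n)).
pose proof (h2 (minus l (x (Datatypes.S n)))) as h5.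
assert (h6 : norm (T n (x (Datatypes.S n))) <= norm (T n l) + norm (T n (minus l (x (Datatypes.S n))))).
{ replace (x (Datatypes.S n)) with (minus l (minus l (x (Datatypes.S n)))) at 1 by (vec; ring).
  rewrite linear_minus; [|apply hT].
  eapply Rle_trans; [apply (norm_triangle (V := H))|]. rewrite (norm_opp (V := H)). lra. }
assert (hS : 0 <= S) by (eapply Rle_trans; [|exact h1]; apply pow_le; lra).
(* The tail after step n costs at most S * 3/2 * 3^-(n+1) = 1/2 * S * 3^-n, which leaves 2/3 - 1/2 =
   1/6 of S * 3^-n. *)
assert (h7 : S * norm (minus l (x (Datatypes.S n))) <= S * (3 / 2 * (/ 3) ^ Datatypes.S n))
  by (now apply Rmult_le_compat_l).
simpl pow in h7.
assert (h8 : (4 / 3) ^ n <= S * (/ 3) ^ n).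
{ unfold Rdiv. rewrite Rpow_mult_distr. apply Rmult_le_compat_r; [apply pow_le; lra | assumption]. }
lra.
Qed.

End UniformBoundedness.

(** * Semigroups with a skew generator *)

Lemma is_RInt_linear (X : Hilbert) (T : X -> X) (f : R -> X) (a b : R) (l : X) :
  is_linear T -> is_RInt f a b l -> is_RInt (fun s => T (f s)) a b (T l).
Proof.
intros hT h.
assert (hR : forall ptd, Riemann_sum (fun s => T (f s)) ptd = T (Riemann_sum f ptd)).
{ intro ptd. apply SF_cons_ind with (s := ptd); clear ptd.
  - intro x0. symmetry. exact (linear_zero T hT).
  - intros p s IH. rewrite !Riemann_sum_cons IH.
    rewrite (linear_plus T hT) (linear_scal T hT). reflexivity. }
apply (filterlim_ext (fun ptd => T (scal (sign (b - a)) (Riemann_sum f ptd)))).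
- intro ptd. rewrite hR (linear_scal T hT). reflexivity.
- exact (filterlim_comp _ _ _ _ T _ _ _ h (linear_cont T l hT)).
Qed.

Definition vright_deriv {X : Hilbert} (f : R -> X) (t : R) (l : X) : Prop :=
  filterlim (fun h => scal (/ h) (minus (f (t + h)) (f t))) (at_right 0) (locally l).

(** The filter is left general in order to cover both ordinary derivatives and the differentiability
    relative to [0, +oo) demanded of a weak solution. *)
Lemma filterdiff_vright_deriv (X : Hilbert) (F : (R -> Prop) -> Prop) (f : R -> X)
    (t : R) (l : X) :
  filter_le (at_right t) F -> filter_le F (locally t) ->
  filterdiff f F (fun h => scal h l) -> vright_deriv f t l.
Proof.
intros hF hFt [_ h]. specialize (h t hFt).
refine (proj2 (filterlim_norm_iff X _ _) _). intros eps heps.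
assert (he2 : 0 < eps / 2) by lra.
destruct (proj1 (at_right_intro _ _) (hF _ (h (mkposreal _ he2)))) as [d [hd hd']].
apply at_right_intro. exists d; split; [assumption|]. intros s hs.
rewrite Rplus_0_l in hs.
specialize (hd' (t + s) ltac:(lra)).
change (minus (t + s) t) with (t + s - t) in hd'.
replace (t + s - t) with s in hd' by ring.
assert (e : minus (scal (/ s) (minus (f (t + s)) (f t))) l =
  scal (/ s) (minus (minus (f (t + s)) (f t)) (scal s l))) by (vec; field; lra).
rewrite e.
assert (hs0 : 0 < / s) by (apply Rinv_0_lt_compat; lra).
rewrite norm_scal_R Rabs_right; [|lra].
change (norm (minus (minus (f (t + s)) (f t)) (scal s l)) <= eps / 2 * Rabs s) in hd'.
rewrite (Rabs_right s) in hd'; [|lra].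
apply (Rmult_le_compat_l (/ s)) in hd'; [|lra].
replace (/ s * (eps / 2 * s)) with (eps / 2) in hd' by (field; lra). lra.
Qed.

Lemma is_derive_vright_deriv (X : Hilbert) (f : R -> X) (t : R) (l : X) :
  is_derive (V := X) f t l -> vright_deriv f t l.
Proof.
apply filterdiff_vright_deriv; [apply filter_le_within | apply filter_le_refl].
Qed.

Section Semigroup.
Variables (X : Hilbert) (G : X -> X -> Prop) (E : R -> X -> X).
Hypothesis hgen : generates G E.
Hypothesis hskew : forall x y, G x y -> inner x y = 0.

Lemma sg_linear t : 0 <= t -> is_linear (E t).
Proof. apply hgen. Qed.
Lemma sg_zero x : E 0 x = x.
Proof. apply hgen. Qed.
Lemma sg_add s t x : 0 <= s -> 0 <= t -> E (s + t) x = E s (E t x).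
Proof. apply hgen. Qed.
Lemma sg_right0 x : filterlim (fun t => E t x) (at_right 0) (locally x).
Proof. apply hgen. Qed.
Lemma sg_generator x y :
  G x y <-> filterlim (fun h => scal (/ h) (minus (E h x) x)) (at_right 0) (locally y).
Proof. apply hgen. Qed.

(** Otherwise some times t_n <= 1/(n+1) have E (t_n) of norm above 4^n; uniform boundedness then
    gives one x with E (t_n) x unbounded, against strong continuity at 0. *)
Lemma sg_bounded_near0 : exists d M, 0 < d /\ 0 <= M /\
  forall t, 0 <= t <= d -> forall x, norm (E t x) <= M * norm x.
Proof.
destruct (classic (exists d M, 0 < d /\ 0 <= M /\
  forall t, 0 <= t <= d -> forall x, norm (E t x) <= M * norm x)) as [|hn]; [assumption|exfalso].
assert (hseq : forall n : nat, exists t, 0 <= t <= / INR (S n) /\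
  exists x, 4 ^ n * norm x < norm (E t x)).
{ intro n. apply NNPP; intro hc. apply hn. exists (/ INR (S n)), (4 ^ n).
  split; [apply Rinv_0_lt_compat, lt_0_INR; lia|]. split; [apply pow_le; lra|].
  intros t ht x. apply Rnot_lt_le; intro hlt. apply hc. exists t; split; [assumption|].
  now exists x. }
set (tn := fun n => proj1_sig (constructive_indefinite_description _ (hseq n))).
assert (htn : forall n, 0 <= tn n <= / INR (S n) /\
  exists x, 4 ^ n * norm x < norm (E (tn n) x))
  by (intro n; exact (proj2_sig (constructive_indefinite_description _ (hseq n)))).
clearbody tn.
destruct (uniform_boundedness X (fun n => E (tn n))) as [x hx].
- intro n. apply sg_linear, htn.
- intro n. apply htn.
- pose proof (proj1 (filterlim_norm_iff X _ _) (sg_right0 x) 1 Rlt_0_1) as h1.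
  apply at_right_intro in h1. destruct h1 as [d [hd h1]].
  destruct (Pow_x_infinity (4 / 3) ltac:(rewrite Rabs_right; lra) (6 * (norm x + 2))) as [N1 hN1].
  destruct (archimed_cor1 d hd) as [N2 [hN2 hN2']].
  set (n := max N1 N2).
  assert (hb : norm (E (tn n) x) <= norm x + 1).
  { destruct (htn n) as [[ht1 ht2] _].
    (* The time may be 0, which the limit from the right does not see. *)
    destruct (Rle_lt_or_eq_dec _ _ ht1) as [hp|hp].
    - assert (hlt : tn n < d).
      { eapply Rle_lt_trans; [exact ht2|]. eapply Rle_lt_trans; [|exact hN2].
        apply Rinv_le_contravar; [apply lt_0_INR; lia | apply le_INR; unfold n; lia]. }
      specialize (h1 (tn n) ltac:(lra)).
      replace (E (tn n) x) with (plus x (minus (E (tn n) x) x)) by (vec; ring).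
      eapply Rle_trans; [apply (norm_triangle (V := X))|]. lra.
    - rewrite -hp sg_zero. lra. }
  specialize (hx n). specialize (hN1 n ltac:(unfold n; lia)).
  rewrite Rabs_right in hN1; [|apply Rle_ge, pow_le; lra].
  pose proof (norm_ge_0 x). lra.
Qed.

(** The semigroup law extends any bound by the fixed length [d], and real induction does the
    counting. *)
Lemma sg_locally_bounded T : 0 <= T -> exists M, 0 <= M /\
  forall t, 0 <= t <= T -> forall x, norm (E t x) <= M * norm x.
Proof.
destruct sg_bounded_near0 as [d [M0 [hd [hM0 h0]]]].
set (bounded := fun T => exists M, 0 <= M /\
  forall t, 0 <= t <= T -> forall x, norm (E t x) <= M * norm x).
assert (hext : forall s T, 0 <= s -> bounded s -> T <= s + d -> bounded T).
{ clear T. intros s T hs [M [hM h]] hT.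
  exists (Rmax M (M0 * M)). split; [eapply Rle_trans; [exact hM | apply Rmax_l]|].
  intros t ht x. pose proof (norm_ge_0 x) as hx.
  destruct (Rle_lt_dec t s).
  - eapply Rle_trans; [apply h; lra|]. apply Rmult_le_compat_r; [assumption | apply Rmax_l].
  - replace t with ((t - s) + s) by ring. rewrite sg_add; [|lra|lra].
    eapply Rle_trans; [apply h0; lra|].
    apply Rle_trans with (M0 * M * norm x).
    + rewrite Rmult_assoc. apply Rmult_le_compat_l; [assumption|]. apply h; lra.
    + apply Rmult_le_compat_r; [assumption | apply Rmax_r]. }
revert T. apply real_induction.
- exists 1; split; [lra|]. intros t ht x. replace t with 0 by lra. rewrite sg_zero; lra.
- intros T hT hb. exists d; split; [assumption|]. intros s hs. apply (hext T); auto; lra.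
- intros T hT hb. set (s := Rmax 0 (T - d)).
  assert (hs : 0 <= s < T) by (unfold s; split; [apply Rmax_l | apply Rmax_lub_lt; lra]).
  assert (hs' : T - d <= s) by apply Rmax_r.
  apply (hext s); [lra | now apply hb | lra].
Qed.

Lemma sg_right_eps x eps : 0 < eps ->
  exists d, 0 < d /\ forall h, 0 <= h < d -> norm (minus (E h x) x) < eps.
Proof.
intro heps.
pose proof (proj1 (filterlim_norm_iff X _ _) (sg_right0 x) eps heps) as h1.
apply at_right_intro in h1. destruct h1 as [d [hd h1]].
exists d; split; [assumption|]. intros h hh.
destruct (Req_dec h 0) as [->|]; [|apply h1; lra].
rewrite sg_zero (minus_eq_zero (G := X)) (norm_zero (V := X)). assumption.
Qed.

(** Orbits are frozen at x for negative times, so that two-sided continuity and integration apply.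
    The local bound is used for E b x - E a x = E a (E (b - a) x - x), where a may vary. *)
Lemma sg_continuous x t : continuous (U := X) (fun s => E (Rmax 0 s) x) t.
Proof.
refine (proj2 (filterlim_norm_iff X _ _) _). intros eps heps.
destruct (sg_locally_bounded (Rmax 0 t + 1)) as [M [hM h]].
{ pose proof (Rmax_l 0 t); lra. }
destruct (sg_right_eps x (eps / (M + 1))) as [d [hd h1]].
{ apply Rdiv_lt_0_compat; lra. }
assert (hm : 0 < Rmin d 1) by (apply Rmin_glb_lt; lra).
exists (mkposreal _ hm). intros s hs. change (Rabs (s - t) < Rmin d 1) in hs.
assert (hlip : Rabs (Rmax 0 s - Rmax 0 t) < Rmin d 1).
{ apply Rabs_def2 in hs. unfold Rmax; repeat destruct (Rle_dec _ _); apply Rabs_def1; lra. }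
pose proof (Rmin_l d 1). pose proof (Rmin_r d 1).
pose proof (Rmax_l 0 s) as hs0. pose proof (Rmax_l 0 t) as ht0.
set (s' := Rmax 0 s) in *. set (t' := Rmax 0 t) in *.
apply Rabs_def2 in hlip.
assert (key : forall a b, 0 <= a <= b -> b <= t' + 1 -> b - a < d ->
  norm (minus (E b x) (E a x)) < eps).
{ intros a b hab hb hba.
  replace (E b x) with (E a (E (b - a) x)).
  - rewrite -linear_minus; [|apply sg_linear; lra].
    eapply Rle_lt_trans; [apply h; lra|].
    specialize (h1 (b - a) ltac:(lra)).
    apply Rle_lt_trans with ((M + 1) * norm (minus (E (b - a) x) x)).
    + apply Rmult_le_compat_r; [apply norm_ge_0 | lra].
    + apply (Rmult_lt_compat_l (M + 1)) in h1; [|lra].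
      replace ((M + 1) * (eps / (M + 1))) with eps in h1 by (field; lra). assumption.
  - rewrite -sg_add; [|lra|lra]. f_equal; ring. }
destruct (Rle_lt_dec s' t').
- rewrite norm_minus_sym. apply key; lra.
- apply key; lra.
Qed.

(** Applying E k shifts the interval of integration by k, so the difference quotient of the integral
    becomes that of a primitive at h minus that at 0; the limit is E h x - x. *)
Lemma sg_mean_in_domain x h : 0 < h ->
  exists y, G (RInt (V := X) (fun s => E (Rmax 0 s) x) 0 h) y.
Proof.
intro hh.
set (f := fun s => E (Rmax 0 s) x).
assert (hex : forall a b, ex_RInt f a b)
  by (intros; apply (ex_RInt_continuous (V := X)); intros; apply sg_continuous).
set (I := fun s => RInt (V := X) f 0 s).
assert (hI : forall s, is_derive (V := X) I s (f s)).
{ intro s. apply (is_derive_RInt (V := X) f I 0 s); [|apply sg_continuous].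
  apply filter_forall; intro r. apply (RInt_correct (V := X)), hex. }
assert (hshift : forall k, 0 < k -> E k (I h) = minus (I (h + k)) (I k)).
{ intros k hk.
  assert (h1 : is_RInt (V := X) (fun s => E k (f s)) 0 h (E k (I h))).
  { apply is_RInt_linear; [apply sg_linear; lra|]. apply (RInt_correct (V := X)), hex. }
  assert (h2 : is_RInt (V := X) f k (h + k) (minus (I (h + k)) (I k))).
  { replace (minus (I (h + k)) (I k)) with (plus (opp (I k)) (I (h + k))) by (vec; ring).
    apply (is_RInt_Chasles (V := X) f k 0 (h + k)).
    - apply (is_RInt_swap (V := X)). apply (RInt_correct (V := X)), hex.
    - apply (RInt_correct (V := X)), hex. }
  assert (h3 : is_RInt (V := X) (fun s => scal 1 (f (1 * s + k))) 0 h (minus (I (h + k)) (I k))).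
  { apply (is_RInt_comp_lin (V := X) f 1 k 0 h).
    replace (1 * 0 + k) with k by ring. now replace (1 * h + k) with (h + k) by ring. }
  rewrite -(is_RInt_unique (V := X) _ _ _ _ h1). apply (is_RInt_unique (V := X)).
  revert h3. apply (is_RInt_ext (V := X)). intros s hs.
  rewrite Rmin_left in hs; [|lra].
  transitivity (f (1 * s + k)); [exact (scal_one (V := X) _)|].
  unfold f. rewrite !Rmax_right; [|lra|lra]. rewrite -sg_add; [|lra|lra]. f_equal; ring. }
assert (hI0 : I 0 = zero) by exact (RInt_point (V := X) 0 f).
exists (minus (f h) (f 0)). apply sg_generator.
apply (filterlim_ext_loc (fun k => minus (scal (/ k) (minus (I (h + k)) (I h)))
  (scal (/ k) (minus (I (0 + k)) (I 0))))).
- apply at_right_intro. exists 1; split; [lra|]. intros k hk.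
  fold f. change (RInt (V := X) f 0 h) with (I h).
  rewrite (hshift k); [|lra]. rewrite hI0 (Rplus_0_l k). vec; ring.
- refine (filterlim_vminus X _ _ _ _ _ _); apply (is_derive_vright_deriv X I); apply hI.
Qed.

(** Together with [sg_mean_in_domain] this gives density of the domain of the generator, with
    explicit approximants. *)
Lemma sg_domain_dense x :
  filterlim (fun h => scal (/ h) (RInt (V := X) (fun s => E (Rmax 0 s) x) 0 h))
    (at_right 0) (locally x).
Proof.
set (f := fun s => E (Rmax 0 s) x).
set (I := fun s => RInt (V := X) f 0 s).
assert (hI : is_derive (V := X) I 0 (f 0)).
{ apply (is_derive_RInt (V := X) f I 0 0); [|apply sg_continuous].
  apply filter_forall; intro r. apply (RInt_correct (V := X)).
  apply (ex_RInt_continuous (V := X)); intros; apply sg_continuous. }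
assert (hI0 : I 0 = zero) by exact (RInt_point (V := X) 0 f).
assert (hf0 : f 0 = x) by (unfold f; rewrite Rmax_left; [apply sg_zero | lra]).
apply (is_derive_vright_deriv X I) in hI. rewrite hf0 in hI.
revert hI. apply filterlim_ext. intro h. rewrite hI0 Rplus_0_l.
unfold I, f. vec; ring.
Qed.

Lemma generator_scal k x y : G x y -> G (scal k x) (scal k y).
Proof.
rewrite !sg_generator. intro h.
apply (filterlim_ext_loc (fun s => scal k (scal (/ s) (minus (E s x) x)))).
- apply at_right_intro. exists 1; split; [lra|]. intros s hs.
  rewrite (linear_scal (E s)); [|apply sg_linear; lra]. vec; ring.
- exact (filterlim_comp _ _ _ _ (scal k) _ _ _ h (filterlim_scal_r (V := X) k y)).
Qed.

Lemma sg_isometry_domain x y t : G x y -> 0 <= t -> inner (E t x) (E t x) = inner x x.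
Proof.
intros hxy ht.
set (u := fun s => E (Rmax 0 s) x).
transitivity (inner (u t) (u t)); [unfold u; now rewrite Rmax_right|].
transitivity (inner (u 0) (u 0)); [|unfold u; rewrite Rmax_left; [now rewrite sg_zero | lra]].
apply (right_deriv_zero_const (fun s => inner (u s) (u s))); [| |assumption].
- intro s. refine (filterlim_inner X _ _ _ _ _ _); apply sg_continuous.
- clear t ht. intros t ht. unfold right_deriv.
  assert (hd : filterlim (fun h => scal (/ h) (minus (u (t + h)) (u t)))
    (at_right 0) (locally (E t y))).
  { apply (filterlim_ext_loc (fun h => E t (scal (/ h) (minus (E h x) x)))).
    - apply at_right_intro. exists 1; split; [lra|]. intros h hh.
      unfold u. rewrite !Rmax_right; [|lra|lra].
      rewrite (linear_scal (E t)); [|now apply sg_linear].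
      rewrite linear_minus; [|now apply sg_linear]. rewrite sg_add; [reflexivity|lra|lra].
    - refine (filterlim_comp _ _ _ _ (E t) _ _ _ (proj1 (sg_generator x y) hxy) _).
      exact (linear_cont (U := X) (V := X) (E t) y (sg_linear t ht)). }
  assert (hu : filterlim (fun h => u (t + h)) (at_right 0) (locally (u t))).
  { refine (filterlim_comp _ _ _ (fun h => t + h) u _ _ _ _ (sg_continuous x t)).
    intros P [d hP]. exists d. intros s hs hs0. apply hP.
    change (Rabs (s - 0) < d) in hs. change (Rabs (t + s - t) < d).
    now replace (t + s - t) with (s - 0) by ring. }
  (* The orbit stays in the domain, with [E t y] as the value of the generator at [u t], so skewness
     applies at time t. *)
  assert (hG : inner (E t y) (plus (u t) (u t)) = 0).
  { assert (h0 : inner (u t) (E t y) = 0).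
    { apply hskew. apply sg_generator. unfold u. rewrite Rmax_right; [|assumption].
      revert hd. apply filterlim_ext_loc. apply at_right_intro. exists 1; split; [lra|].
      intros h hh. unfold u. rewrite !Rmax_right; [|lra|lra].
      rewrite -sg_add; [|lra|lra]. now rewrite Rplus_comm. }
    rewrite inner_plus_r (inner_sym (E t y)) h0. ring. }
  cut (filterlim (fun h => (inner (u (t + h)) (u (t + h)) - inner (u t) (u t)) / h)
    (at_right 0) (locally (inner (E t y) (plus (u t) (u t))))); [now rewrite hG|].
  apply (filterlim_ext (fun h => inner (scal (/ h) (minus (u (t + h)) (u t)))
    (plus (u (t + h)) (u t)))).
  + intro h. rewrite inner_scal_l inner_minus_l !inner_plus_r (inner_sym (u (t + h)) (u t)).
    unfold Rdiv; ring.
  + refine (filterlim_inner X _ _ _ _ _ _); [exact hd|].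
    refine (filterlim_vplus X _ _ _ _ _ _); [exact hu | exact (filterlim_const (U := X) _)].
Qed.

(** Both sides are continuous in x, and the means [m h] are points of the domain converging to x. *)
Lemma sg_isometry t x : 0 <= t -> inner (E t x) (E t x) = inner x x.
Proof.
intro ht.
set (m := fun h => scal (/ h) (RInt (V := X) (fun s => E (Rmax 0 s) x) 0 h)).
pose proof (sg_domain_dense x) as hm. fold m in hm.
assert (hEm : filterlim (fun h => E t (m h)) (at_right 0) (locally (E t x))).
{ refine (filterlim_comp _ _ _ _ (E t) _ _ _ hm _).
  exact (linear_cont (U := X) (V := X) (E t) x (sg_linear t ht)). }
apply (filterlim_locally_unique (V := R_NormedModule) (F := at_right 0)
  (fun h => inner (E t (m h)) (E t (m h)))).
- now refine (filterlim_inner X _ _ _ _ _ _).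
- apply (filterlim_ext_loc (fun h => inner (m h) (m h))); [|now refine (filterlim_inner X _ _ _ _ _ _)].
  apply at_right_intro. exists 1; split; [lra|]. intros h hh.
  destruct (sg_mean_in_domain x h ltac:(lra)) as [y hy].
  symmetry. apply (sg_isometry_domain _ (scal (/ h) y)); [|assumption].
  now apply generator_scal.
Qed.

Lemma sg_inner t x y : 0 <= t -> inner (E t x) (E t y) = inner x y.
Proof.
intro ht. pose proof (sg_isometry t (plus x y) ht) as h.
rewrite (linear_plus (E t)) in h; [|now apply sg_linear].
rewrite !inner_plus_l !inner_plus_r !sg_isometry in h; [|assumption|assumption].
rewrite (inner_sym y x) (inner_sym (E t y) (E t x)) in h. lra.
Qed.

Lemma sg_norm t x : 0 <= t -> norm (E t x) = norm x.
Proof.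
intro ht. apply Rsqr_inj; try apply norm_ge_0.
rewrite !Rsqr_pow2 -!inner_norm. now apply sg_isometry.
Qed.

(** By isometry <E h x - x, w> = - <E h x, E h w - w>, so the difference quotient falls on w and x
    may be outside the domain. *)
Lemma sg_weak_generator x w y : G w y ->
  filterlim (fun h => / h * inner (minus (E h x) x) w) (at_right 0) (locally (- inner x y)).
Proof.
intro hw. rewrite -inner_opp_r.
apply (filterlim_ext_loc (fun h => inner (E h x) (opp (scal (/ h) (minus (E h w) w))))).
- apply at_right_intro. exists 1; split; [lra|]. intros h hh.
  rewrite inner_opp_r inner_scal_r inner_minus_l inner_minus_r sg_inner; [|lra]. ring.
- refine (filterlim_inner X _ _ _ _ _ _); [apply sg_right0|].
  refine (filterlim_vopp X _ _ _). now apply sg_generator.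
Qed.

(** * Right derivatives along mild solutions *)

Section Mild.
Variables (U g : R -> X).
Hypothesis hg : forall t, 0 <= t ->
  filterlim (fun h => g (t + h)) (at_right 0) (locally (g t)).
Hypothesis hU : forall t, 0 <= t ->
  filterlim (fun h => U (t + h)) (at_right 0) (locally (U t)).
Hypothesis hmild : forall t, 0 <= t ->
  is_RInt (V := X) (fun s => E (t - s) (g s)) 0 t (minus (U t) (E t (U 0))).

(** The Duhamel formula restarted at time t: [E h] is moved inside the integral over [0, t]. *)
Lemma mild_increment t h : 0 <= t -> 0 < h ->
  is_RInt (V := X) (fun s => E (t + h - s) (g s)) t (t + h) (minus (U (t + h)) (E h (U t))).
Proof.
intros ht hh.
replace (minus (U (t + h)) (E h (U t))) with
  (plus (opp (E h (minus (U t) (E t (U 0))))) (minus (U (t + h)) (E (t + h) (U 0)))).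
- apply (is_RInt_Chasles (V := X) _ t 0 (t + h)); [|apply hmild; lra].
  apply (is_RInt_swap (V := X)).
  apply (is_RInt_ext (V := X) (fun s => E h (E (t - s) (g s)))).
  + intros s hs. rewrite Rmin_left in hs; [|lra]. rewrite Rmax_right in hs; [|lra].
    rewrite -sg_add; [|lra|lra]. f_equal; ring.
  + apply is_RInt_linear; [apply sg_linear; lra | now apply hmild].
- rewrite (linear_minus (E h)); [|apply sg_linear; lra].
  rewrite -sg_add; [|lra|lra]. rewrite (Rplus_comm h t). vec; ring.
Qed.

(** U itself need not be differentiable, but its deviation from the free flow is: the integrand of
    [mild_increment] is within eps/2 of [g t], half of it from g, as E is isometric, and half from
    the orbit of [g t]. *)
Lemma mild_right_deriv t : 0 <= t ->
  filterlim (fun h => scal (/ h) (minus (U (t + h)) (E h (U t)))) (at_right 0) (locally (g t)).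
Proof.
intro ht. refine (proj2 (filterlim_norm_iff X _ _) _). intros eps heps.
destruct (sg_right_eps (g t) (eps / 4)) as [d1 [hd1 h1]]; [lra|].
pose proof (proj1 (filterlim_norm_iff X _ _) (hg t ht) (eps / 4) ltac:(lra)) as h2.
apply at_right_intro in h2. destruct h2 as [d2 [hd2 h2]].
apply at_right_intro. exists (Rmin d1 d2). split; [now apply Rmin_glb_lt|].
intros h hh. pose proof (Rmin_l d1 d2). pose proof (Rmin_r d1 d2).
assert (hI : is_RInt (V := X) (fun s => minus (E (t + h - s) (g s)) (g t)) t (t + h)
  (minus (minus (U (t + h)) (E h (U t))) (scal (t + h - t) (g t)))).
{ apply (is_RInt_minus (V := X)); [apply mild_increment; lra|]. apply (is_RInt_const (V := X)). }
apply (norm_RInt_le_const (V := X) _ _ _ _ (eps / 2)) in hI; [|lra|].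
- replace (t + h - t) with h in hI by ring.
  assert (e : minus (scal (/ h) (minus (U (t + h)) (E h (U t)))) (g t) =
    scal (/ h) (minus (minus (U (t + h)) (E h (U t))) (scal h (g t)))) by (vec; field; lra).
  rewrite e.
  assert (hh0 : 0 < / h) by (apply Rinv_0_lt_compat; lra).
  rewrite norm_scal_R Rabs_right; [|lra].
  apply (Rmult_le_compat_l (/ h)) in hI; [|lra].
  replace (/ h * (h * (eps / 2))) with (eps / 2) in hI by (field; lra). lra.
- intros s hs.
  replace (minus (E (t + h - s) (g s)) (g t)) with
    (plus (E (t + h - s) (minus (g s) (g t))) (minus (E (t + h - s) (g t)) (g t)))
    by (rewrite (linear_minus (E (t + h - s))); [vec; ring | apply sg_linear; lra]).
  eapply Rle_trans; [apply (norm_triangle (V := X))|].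
  rewrite sg_norm; [|lra].
  specialize (h1 (t + h - s) ltac:(lra)).
  assert (h3 : norm (minus (g s) (g t)) <= eps / 4).
  { destruct (Req_dec s t) as [->|hne].
    - rewrite (minus_eq_zero (G := X)) (norm_zero (V := X)). lra.
    - specialize (h2 (s - t) ltac:(lra)). replace (t + (s - t)) with s in h2 by ring. lra. }
  lra.
Qed.

(** As E h is isometric, |U(t+h)|^2 - |U(t)|^2 is the product of U(t+h) - E h U(t) with U(t+h) + E h
    U(t), and only the first factor needs a derivative. *)
Lemma mild_energy_right_deriv t : 0 <= t ->
  right_deriv (fun s => inner (U s) (U s)) t (2 * inner (g t) (U t)).
Proof.
intro ht. unfold right_deriv.
replace (2 * inner (g t) (U t)) with (inner (g t) (plus (U t) (U t)))
  by (rewrite inner_plus_r; ring).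
apply (filterlim_ext_loc (fun h => inner (scal (/ h) (minus (U (t + h)) (E h (U t))))
  (plus (U (t + h)) (E h (U t))))).
- apply at_right_intro. exists 1; split; [lra|]. intros h hh.
  rewrite inner_scal_l inner_minus_l !inner_plus_r (inner_sym (E h (U t)) (U (t + h))).
  rewrite (sg_isometry h (U t)); [|lra]. unfold Rdiv; ring.
- refine (filterlim_inner X _ _ _ _ _ _); [now apply mild_right_deriv|].
  refine (filterlim_vplus X _ _ _ _ _ _); [now apply hU | apply sg_right0].
Qed.

Lemma mild_weak_right_deriv w y t : G w y -> 0 <= t ->
  right_deriv (fun s => inner (U s) w) t (inner (g t) w - inner (U t) y).
Proof.
intros hw ht. unfold right_deriv.
apply (filterlim_ext_loc (fun h => plus (inner (scal (/ h) (minus (U (t + h)) (E h (U t)))) w)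
  (/ h * inner (minus (E h (U t)) (U t)) w))).
- apply at_right_intro. exists 1; split; [lra|]. intros h hh.
  change (inner (scal (/ h) (minus (U (t + h)) (E h (U t)))) w
    + / h * inner (minus (E h (U t)) (U t)) w = (inner (U (t + h)) w - inner (U t) w) / h).
  rewrite inner_scal_l !inner_minus_l. unfold Rdiv; ring.
- refine (filterlim_comp_2 _ _ plus _ (sg_weak_generator (U t) w y hw)
    (filterlim_plus (V := R_NormedModule) _ _)).
  refine (filterlim_inner X _ _ _ _ _ _); [now apply mild_right_deriv | exact (filterlim_const (U := X) _)].
Qed.

End Mild.
End Semigroup.

(** * The phase space as a Hilbert space *)

Section PhaseHilbert.
Variables (H : Hilbert) (B : linear_op H).
Hypothesis hB : self_adjoint B.

Lemma sa_symmetric x y : dom B x -> dom B y -> inner (B x) y = inner x (B y).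
Proof.
intros hx hy. destruct hB as [_ h]. exact (proj2 (h y (B y)) (conj hy eq_refl) x hx).
Qed.

(** B coincides with its adjoint, and the adjoint relation passes to limits. *)
Lemma sa_closed {T : Type} (F : (T -> Prop) -> Prop) (f : T -> H) (l m : H) :
  ProperFilter F -> (forall t, dom B (f t)) ->
  filterlim f F (locally l) -> filterlim (fun t => B (f t)) F (locally m) ->
  dom B l /\ B l = m.
Proof.
intros PF hdom hl hm. apply hB. intros u hu.
apply (filterlim_locally_unique (V := R_NormedModule) (F := F) (fun t => inner (B u) (f t))).
- refine (filterlim_inner H _ _ _ _ _ hl). exact (filterlim_const (U := H) _).
- apply (filterlim_ext (fun t => inner u (B (f t)))).
  + intro t. symmetry. now apply sa_symmetric.
  + refine (filterlim_inner H _ _ _ _ _ hm). exact (filterlim_const (U := H) _).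
Qed.

Lemma dnorm_sq (x : dom_space B) : dnorm x ^ 2 = norm (incl x) ^ 2 + norm (B (incl x)) ^ 2.
Proof.
unfold dnorm. rewrite pow2_sqrt; [reflexivity|].
pose proof (pow2_ge_0 (norm (incl x))). pose proof (pow2_ge_0 (norm (B (incl x)))). lra.
Qed.

Lemma dnorm_pos (x : dom_space B) : 0 <= dnorm x.
Proof. apply sqrt_pos. Qed.

Lemma norm_incl_le (x : dom_space B) : norm (incl x) <= dnorm x.
Proof.
apply Rsqr_incr_0_var; [|apply dnorm_pos]. rewrite !Rsqr_pow2 dnorm_sq.
pose proof (pow2_ge_0 (norm (B (incl x)))). lra.
Qed.

Lemma norm_app_le (x : dom_space B) : norm (B (incl x)) <= dnorm x.
Proof.
apply Rsqr_incr_0_var; [|apply dnorm_pos]. rewrite !Rsqr_pow2 dnorm_sq.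
pose proof (pow2_ge_0 (norm (incl x))). lra.
Qed.

Lemma dnorm_le (x : dom_space B) : dnorm x <= norm (incl x) + norm (B (incl x)).
Proof.
pose proof (norm_ge_0 (incl x)). pose proof (norm_ge_0 (B (incl x))).
apply Rsqr_incr_0_var; [|lra]. rewrite !Rsqr_pow2 dnorm_sq. nra.
Qed.

Lemma app_minus x y : dom B x -> dom B y -> B (minus x y) = minus (B x) (B y).
Proof.
intros hx hy.
assert (e : minus x y = plus x (scal (- (1)) y)) by (vec; ring).
rewrite e app_plus; [|assumption|now apply dom_scal].
rewrite app_scal; [|assumption]. vec; ring.
Qed.

Lemma dom_minus x y : dom B x -> dom B y -> dom B (minus x y).
Proof.
intros hx hy. apply dom_plus; [assumption|]. now apply dom_opp.
Qed.

Notation V := (dom_space B).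

Lemma filterlim_dom_iff {T : Type} {F : (T -> Prop) -> Prop} {FF : Filter F}
  (f : T -> V) (y : V) :
  filterlim f F (locally y) <->
  filterlim (fun t => incl (f t)) F (locally (incl y)) /\
  filterlim (fun t => B (incl (f t))) F (locally (B (incl y))).
Proof.
assert (hm : forall t, incl (minus (f t) y) = minus (incl (f t)) (incl y)) by reflexivity.
assert (hBm : forall t, B (incl (minus (f t) y)) = minus (B (incl (f t))) (B (incl y))).
{ intro t. rewrite hm. apply app_minus; apply incl_dom. }
split.
- intro h.
  assert (h' : forall eps, 0 < eps -> F (fun t => dnorm (minus (f t) y) < eps)).
  { intros eps heps. exact (proj1 (filterlim_locally f y) h (mkposreal eps heps)). }
  split; refine (proj2 (filterlim_norm_iff H _ _) _); intros eps heps;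
    generalize (h' eps heps); apply filter_imp; intros t ht.
  + rewrite -hm. eapply Rle_lt_trans; [apply norm_incl_le | exact ht].
  + rewrite -hBm. eapply Rle_lt_trans; [apply norm_app_le | exact ht].
- intros [h1 h2]. apply filterlim_locally. intro eps.
  assert (he : 0 < eps / 2) by (pose proof (cond_pos eps); lra).
  pose proof (proj1 (filterlim_norm_iff H _ _) h1 _ he) as k1.
  pose proof (proj1 (filterlim_norm_iff H _ _) h2 _ he) as k2.
  generalize (filter_and _ _ k1 k2); apply filter_imp. intros t [a b].
  change (dnorm (minus (f t) y) < eps).
  eapply Rle_lt_trans; [apply dnorm_le|]. rewrite hm hBm. lra.
Qed.

(** The three components u, B u and v converge in H; closedness of B reassembles the first two
    limits into a point of its domain. *)
Lemma phase_limit_exists (F : (phase_space B -> Prop) -> Prop) :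
  ProperFilter F -> cauchy F -> exists l : phase_space B, forall eps : posreal, F (ball l eps).
Proof.
intros PF hF.
set (f1 := fun x : phase_space B => incl (fst x)).
set (f2 := fun x : phase_space B => B (incl (fst x))).
set (f3 := fun x : phase_space B => snd x : H).
assert (hlim : forall f : phase_space B -> H,
  (forall eps, 0 < eps -> exists d : posreal, forall x y,
    ball x d y -> norm (minus (f y) (f x)) < eps) ->
  exists l, filterlim f F (locally l)).
{ intros f hf.
  destruct (hilbert_complete H (filtermap f F) (filtermap_proper_filter _ _ f F PF)) as [l hl].
  - intros eps heps. destruct (hf eps heps) as [d hd]. destruct (hF d) as [x hx].
    exists (f x). unfold filtermap. revert hx. apply filter_imp. intros y hy. now apply hd.
  - exists l. refine (proj2 (filterlim_norm_iff H _ _) _). exact hl. }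
assert (hm : forall x y : V, incl (minus x y) = minus (incl x) (incl y)) by reflexivity.
destruct (hlim f1) as [l1 hl1].
{ intros eps heps. exists (mkposreal eps heps). intros x y [h _]. unfold f1.
  rewrite -hm. eapply Rle_lt_trans; [apply norm_incl_le | exact h]. }
destruct (hlim f2) as [l2 hl2].
{ intros eps heps. exists (mkposreal eps heps). intros x y [h _]. unfold f2.
  rewrite -app_minus; [|apply incl_dom|apply incl_dom].
  rewrite -hm. eapply Rle_lt_trans; [apply norm_app_le | exact h]. }
destruct (hlim f3) as [l3 hl3].
{ intros eps heps.
  assert (hn : 0 < norm_factor (V := H)) by apply norm_factor_gt_0.
  assert (hd : 0 < eps / norm_factor (V := H)) by (apply Rdiv_lt_0_compat; assumption).
  exists (mkposreal _ hd). intros x y [_ h].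
  apply (norm_compat2 (V := H)) in h. simpl in h. unfold f3.
  replace (norm_factor (V := H) * (eps / norm_factor (V := H))) with eps in h;
    [exact h | field; lra]. }
destruct (sa_closed F f1 l1 l2 PF (fun x => incl_dom (fst x)) hl1 hl2) as [hdom heq].
exists (MkDom hdom, l3). intro eps.
assert (h1 : filterlim (fun x : phase_space B => fst x) F (locally (MkDom hdom : V))).
{ apply filterlim_dom_iff. split; [exact hl1|]. simpl. rewrite heq. exact hl2. }
pose proof (proj1 (filterlim_locally _ _) h1 eps) as k1.
pose proof (proj1 (filterlim_locally (U := H) _ _) hl3 eps) as k3.
generalize (filter_and _ _ k1 k3). apply filter_imp. intros x hx. exact hx.
Qed.

(** A complete space carries a limit for every family of sets, so one is chosen; its value matters
    only for Cauchy filters. *)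
Definition phase_lim (F : (phase_space B -> Prop) -> Prop) : phase_space B :=
  epsilon (inhabits (zero : phase_space B)) (fun l => forall eps : posreal, F (ball l eps)).

Lemma phase_lim_cauchy (F : (phase_space B -> Prop) -> Prop) :
  ProperFilter F -> cauchy F -> forall eps : posreal, F (ball (phase_lim F) eps).
Proof.
intros PF hF. unfold phase_lim. apply epsilon_spec. now apply phase_limit_exists.
Qed.

(** The choice respects equality of filters only, so mutually finer filters are identified by
    extensionality. *)
Lemma phase_lim_close (F1 F2 : (phase_space B -> Prop) -> Prop) :
  filter_le F1 F2 -> filter_le F2 F1 -> close (phase_lim F1) (phase_lim F2).
Proof.
intros h12 h21.
replace F2 with F1; [apply close_refl|].
apply functional_extensionality; intro P. apply propositional_extensionality.
split; [apply h21 | apply h12].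
Qed.

Definition phase_complete : CompleteNormedModule R_AbsRing :=
  CompleteNormedModule.Pack R_AbsRing (phase_space B)
    (CompleteNormedModule.Class R_AbsRing (phase_space B)
      (NormedModule.class R_AbsRing (phase_space B))
      (CompleteSpace.Mixin _ phase_lim phase_lim_cauchy phase_lim_close)) (phase_space B).

Definition phase_inner (x y : phase_space B) : R :=
  inner (incl (fst x)) (incl (fst y)) + inner (B (incl (fst x))) (B (incl (fst y)))
  + inner (snd x : H) (snd y).

Lemma phase_inner_sym x y : phase_inner x y = phase_inner y x.
Proof.
unfold phase_inner. rewrite (inner_sym (incl _)) (inner_sym (B _)) (inner_sym (snd x : H)).
reflexivity.
Qed.

Lemma phase_inner_plus_l x y z :
  phase_inner (plus x y) z = phase_inner x z + phase_inner y z.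
Proof.
unfold phase_inner.
change (snd (plus x y)) with (plus (snd x : H) (snd y)).
change (incl (fst (plus x y))) with (plus (incl (fst x)) (incl (fst y))).
rewrite app_plus; [|apply incl_dom|apply incl_dom]. rewrite !inner_plus_l. ring.
Qed.

Lemma phase_inner_scal_l (k : R) x y : phase_inner (scal k x) y = k * phase_inner x y.
Proof.
unfold phase_inner.
change (snd (scal k x)) with (scal k (snd x : H)).
change (incl (fst (scal k x))) with (scal k (incl (fst x))).
rewrite app_scal; [|apply incl_dom]. rewrite !inner_scal_l. ring.
Qed.

Lemma phase_inner_norm x : phase_inner x x = norm x ^ 2.
Proof.
change (norm x) with (sqrt (dnorm (fst x) ^ 2 + norm (snd x : H) ^ 2)).
rewrite pow2_sqrt.
- unfold phase_inner. rewrite dnorm_sq !inner_norm. reflexivity.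
- pose proof (pow2_ge_0 (dnorm (fst x))). pose proof (pow2_ge_0 (norm (snd x : H))). lra.
Qed.

(** Built over the normed module [phase_space] itself, so the limits and integrals in the notion of
    weak solution are, by conversion, those of this Hilbert space. *)
Definition phase_hilbert : Hilbert :=
  @MkHilbert phase_complete phase_inner phase_inner_sym phase_inner_plus_l
    phase_inner_scal_l phase_inner_norm.

End PhaseHilbert.

(** * The kernel of A and the projection onto its orthogonal complement *)

Section Kernel.
Variables (H : Hilbert) (A B : linear_op H).
Hypothesis hsqrt : is_op_sqrt A B.

Let hB : self_adjoint B.
Proof. apply hsqrt. Qed.

Lemma op_zero (C : linear_op H) : C zero = zero.
Proof.
transitivity (C (scal 0 zero)).
- f_equal. symmetry. exact (scal_zero_l (V := H) zero).
- rewrite app_scal; [|apply dom_zero]. exact (scal_zero_l (V := H) _).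
Qed.

(** For u in ker A one has |B u|^2 = <u, A u> = 0. *)
Lemma in_ker_sqrt u : in_ker A u <-> dom B u /\ B u = zero.
Proof.
destruct hsqrt as [_ [_ [hdom happ]]]. split.
- intros [hu h0]. destruct (proj1 (hdom u) hu) as [h1 h2]. split; [assumption|].
  apply (norm_eq_zero (V := H)).
  assert (h : norm (B u) ^ 2 = 0).
  { rewrite -inner_norm (sa_symmetric H B hB); [|assumption|assumption].
    rewrite -happ; [|assumption]. rewrite h0. apply inner_zero_r. }
  pose proof (norm_ge_0 (B u)). nra.
- intros [hu h0].
  assert (hd : dom A u) by (apply hdom; split; [assumption | rewrite h0; apply dom_zero]).
  split; [assumption|]. rewrite happ; [|assumption]. rewrite h0. apply op_zero.
Qed.

(** Q is x minus its projection onto the kernel. The second clause encodes symmetry and idempotence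
    at once; B Q = B on D(B) because the part removed is killed by B. *)
Lemma kernel_complement_exists : exists Q : H -> H,
  is_linear Q /\
  (forall x y, inner (Q x) y = inner (Q x) (Q y)) /\
  (forall x, in_ker_orth A (Q x)) /\
  (forall x, dom B x -> dom B (Q x) /\ B (Q x) = B x).
Proof.
assert (hP : forall x : H, exists y, in_ker A y /\ forall w, in_ker A w -> inner (minus x y) w = 0).
{ apply orthogonal_projection_exists.
  - apply in_ker_sqrt. split; [apply dom_zero | apply op_zero].
  - intros x y. rewrite !in_ker_sqrt. intros [h1 h2] [h3 h4].
    split; [now apply dom_plus|]. rewrite app_plus; [|assumption|assumption].
    rewrite h2 h4. exact (plus_zero_l (G := H) _).
  - intros k x. rewrite !in_ker_sqrt. intros [h1 h2].
    split; [now apply dom_scal|]. rewrite app_scal; [|assumption].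
    rewrite h2. exact (scal_zero_r (V := H) _).
  (* Closedness of the kernel: x lies in it as soon as <B u, x> = 0 for all u in D(B), a condition
     stable under approximation. *)
  - intros x hx. apply in_ker_sqrt. apply hB. intros u hu. rewrite inner_zero_r.
    apply NNPP; intro hne. pose proof (norm_ge_0 (B u)) as hn.
    assert (he : 0 < Rabs (inner (B u) x) / (norm (B u) + 1)).
    { apply Rdiv_lt_0_compat; [now apply Rabs_pos_lt | lra]. }
    destruct (hx _ he) as [y [hy hyx]]. apply in_ker_sqrt in hy. destruct hy as [hy1 hy2].
    assert (h0 : inner (B u) (minus y x) = - inner (B u) x).
    { rewrite inner_minus_r (sa_symmetric H B hB); [|assumption|assumption].
      rewrite hy2 inner_zero_r. ring. }
    pose proof (inner_Cauchy_Schwarz H (B u) (minus y x)) as hcs.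
    rewrite h0 Rabs_Ropp in hcs.
    pose proof (norm_ge_0 (minus y x)).
    apply (Rmult_lt_compat_r (norm (B u) + 1)) in hyx; [|lra].
    replace (Rabs (inner (B u) x) / (norm (B u) + 1) * (norm (B u) + 1))
      with (Rabs (inner (B u) x)) in hyx by (field; lra).
    nra. }
set (P := fun x : H => proj1_sig (constructive_indefinite_description _ (hP x))).
assert (hP' : forall x : H, in_ker A (P x) /\ forall w, in_ker A w -> inner (minus x (P x)) w = 0)
  by (intro x; exact (proj2_sig (constructive_indefinite_description _ (hP x)))).
clearbody P.
set (Q := fun x : H => minus x (P x)).
assert (hQ : forall x y : H, inner (Q x) y = inner (Q x) (Q y)).
{ intros x y. unfold Q at 3. rewrite inner_minus_r. unfold Q at 3.
  rewrite (proj2 (hP' x) (P y)); [ring | apply hP']. }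
assert (hQsym : forall x y : H, inner (Q x) y = inner x (Q y)).
{ intros x y. rewrite hQ inner_sym -hQ. apply inner_sym. }
exists Q. split; [|split; [assumption|split]].
- constructor.
  + intros x y. apply inner_ext; intro z.
    rewrite hQsym inner_plus_l inner_plus_l !hQsym. reflexivity.
  + intros k x. apply inner_ext; intro z.
    rewrite hQsym inner_scal_l inner_scal_l !hQsym. reflexivity.
  + exists 1; split; [lra|]. intro x.
    assert (h : norm (Q x) ^ 2 <= norm (Q x) * norm x).
    { rewrite -inner_norm -hQ. apply inner_le. }
    pose proof (norm_ge_0 (Q x)). pose proof (norm_ge_0 x).
    destruct (Req_dec (norm (Q x)) 0); nra.
- intros x w hw. now apply hP'.
- intros x hx. destruct (hP' x) as [hk _]. apply in_ker_sqrt in hk. destruct hk as [hk1 hk2].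
  split; [now apply dom_minus|]. unfold Q. rewrite app_minus; [|assumption|assumption].
  rewrite hk2. vec; ring.
Qed.

End Kernel.

(** * Derivatives along a solution *)

Section Derivatives.
Variables (H : Hilbert) (A B : linear_op H).
Hypothesis hsqrt : is_op_sqrt A B.
Variables (F : dom_space B -> R) (gradF : dom_space B -> H).
Hypotheses (hgrad : is_gradient F gradF) (hlip : locally_lipschitz gradF).
Variables (u : R -> dom_space B) (u' : R -> H).
Hypotheses (cu : forall t, continuous u t) (cu' : forall t, continuous (U := H) u' t).
Hypothesis du : forall t, 0 <= t -> vright_deriv (fun s => incl (u s)) t (u' t).
Variable E : R -> phase_space B -> phase_space B.
Hypothesis hE : generates (fun x y => wave_graph A x (opp y)) E.
Hypothesis hmild : forall t, 0 <= t ->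
  is_RInt (fun s => E (t - s) (wave_force gradF (u s, u' s))) 0 t
    (minus ((u t, u' t) : phase_space B) (E t (u 0, u' 0))).

Let hB : self_adjoint B.
Proof. apply hsqrt. Qed.
Let X := phase_hilbert H B hB.

(** The remainder is small relative to the norm of H, while y has to be close in the graph norm.
    This is what allows F(u(t)) to be differentiated although u is differentiable only in H. *)
Lemma gradient_increment (x : dom_space B) eps : 0 < eps ->
  exists d, 0 < d /\ forall y, norm (minus y x) < d ->
    Rabs (F y - F x - inner (gradF x) (minus (incl y) (incl x)))
      <= eps * norm (minus (incl y) (incl x)).
Proof.
intro heps.
pose proof (proj1 (filterlim_locally _ _) (hgrad x) (mkposreal eps heps)) as [d hd].
exists d; split; [apply cond_pos|]. intros y hy.
assert (hw : plus x (minus y x) = y).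
{ apply incl_inj. change (plus (incl x) (minus (incl y) (incl x)) = incl y). vec; ring. }
destruct (classic (minus y x = zero)) as [h0|hne].
- assert (hyx : y = x) by (rewrite -hw h0; exact (plus_zero_r (G := dom_NormedModule B) x)).
  assert (hz : minus (incl x) (incl x) = zero) by exact (minus_eq_zero (G := H) (incl x)).
  rewrite hyx hz inner_zero_r (norm_zero (V := H)).
  replace (F x - F x - 0) with 0 by ring. rewrite Rabs_R0. lra.
- assert (hb : ball (zero : dom_space B) d (minus y x)).
  { change (dnorm (minus (minus y x) zero) < d).
    assert (e : minus (minus y x) zero = (minus y x : dom_space B))
      by (exact (minus_zero_r (G := dom_NormedModule B) (minus y x))).
    rewrite e. exact hy. }
  specialize (hd (minus y x) hb hne).
  rewrite hw in hd.
  change (incl (minus y x)) with (minus (incl y) (incl x)) in hd.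
  set (r := F y - F x - inner (gradF x) (minus (incl y) (incl x))) in *.
  set (n := norm (minus (incl y) (incl x))) in *.
  change (Rabs (r / n - 0) < eps) in hd. rewrite Rminus_0_r in hd.
  assert (hn : 0 < n).
  { destruct (Rle_lt_or_eq_dec 0 n (norm_ge_0 _)) as [|hn]; [assumption|].
    exfalso; apply hne. apply incl_inj.
    exact (norm_eq_zero (V := H) _ (eq_sym hn)). }
  replace r with (r / n * n) by (field; lra).
  rewrite Rabs_mult (Rabs_right n); [|lra].
  apply Rmult_le_compat_r; lra.
Qed.

Lemma potential_continuous (x : dom_space B) : continuous F x.
Proof.
apply filterlim_locally. intro eps.
destruct (gradient_increment x 1 Rlt_0_1) as [d [hd h]].
pose proof (norm_ge_0 (gradF x)) as hg.
set (K := norm (gradF x) + 1).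
assert (hm : 0 < Rmin d (eps / K)).
{ apply Rmin_glb_lt; [assumption|]. apply Rdiv_lt_0_compat; [apply cond_pos | unfold K; lra]. }
exists (mkposreal _ hm). intros y hy.
change (dnorm (minus y x) < Rmin d (eps / K)) in hy.
specialize (h y (Rlt_le_trans _ _ _ hy (Rmin_l _ _))).
assert (hn : norm (minus (incl y) (incl x)) < eps / K).
{ eapply Rle_lt_trans; [apply (norm_incl_le H B (minus y x))|].
  eapply Rlt_le_trans; [exact hy | apply Rmin_r]. }
apply (Rmult_lt_compat_l K) in hn; [|unfold K; lra].
replace (K * (eps / K)) with (eps : R) in hn by (field; unfold K; lra).
pose proof (inner_Cauchy_Schwarz H (gradF x) (minus (incl y) (incl x))) as hcs.
change (Rabs (F y - F x) < eps).
replace (F y - F x) with ((F y - F x - inner (gradF x) (minus (incl y) (incl x)))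
  + inner (gradF x) (minus (incl y) (incl x))) by ring.
eapply Rle_lt_trans; [apply Rabs_triang|]. unfold K in hn. lra.
Qed.

Lemma gradient_continuous (x : dom_space B) : continuous gradF x.
Proof.
destruct hlip as [L [hL h]].
destruct (hL (norm x + 1)) as [M hM].
assert (hM0 : 0 <= M).
{ eapply Rle_trans; [apply Rabs_pos|].
  apply (hM 0 0); rewrite Rabs_R0; pose proof (norm_ge_0 x); lra. }
refine (proj2 (filterlim_norm_iff H _ _) _). intros eps heps.
assert (hm : 0 < Rmin 1 (eps / (M + 1))).
{ apply Rmin_glb_lt; [lra|]. apply Rdiv_lt_0_compat; lra. }
exists (mkposreal _ hm). intros y hy.
change (norm (minus y x) < Rmin 1 (eps / (M + 1))) in hy.
pose proof (Rmin_l 1 (eps / (M + 1))). pose proof (Rmin_r 1 (eps / (M + 1))).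
pose proof (norm_ge_0 x) as hx0. pose proof (norm_ge_0 y) as hy0.
pose proof (norm_ge_0 (minus y x)) as hyx0.
assert (hyx : norm y <= norm x + 1).
{ pose proof (norm_triangle_inv y x) as ht.
  change (Rabs (norm y - norm x) <= norm (minus y x)) in ht. apply Rabs_le_between in ht. lra. }
specialize (h y x). eapply Rle_lt_trans; [exact h|].
assert (hL0 : Rabs (L (norm y) (norm x)) <= M) by (apply hM; rewrite Rabs_right; lra).
pose proof (Rle_abs (L (norm y) (norm x))).
assert (h3 : norm (minus y x) < eps / (M + 1)) by lra.
apply (Rmult_lt_compat_l (M + 1)) in h3; [|lra].
replace ((M + 1) * (eps / (M + 1))) with eps in h3 by (field; lra).
nra.
Qed.

Let g t := gradF (u t).

Lemma continuous_gradient_along t : continuous (U := H) g t.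
Proof. exact (continuous_comp u gradF t (cu t) (gradient_continuous (u t))). Qed.

Lemma continuous_incl t : continuous (U := H) (fun s => incl (u s)) t.
Proof. exact (proj1 (proj1 (filterlim_dom_iff H B u (u t)) (cu t))). Qed.

Lemma continuous_sqrt_along t : continuous (U := H) (fun s => B (incl (u s))) t.
Proof. exact (proj2 (proj1 (filterlim_dom_iff H B u (u t)) (cu t))). Qed.

Lemma continuous_inner (f k : R -> H) t : continuous (U := H) f t -> continuous (U := H) k t ->
  continuous (fun s => inner (f s) (k s)) t.
Proof. intros hf hk. exact (filterlim_inner H f k _ _ hf hk). Qed.

Lemma phase_right_continuous (f : R -> dom_space B) (k : R -> H) t :
  filterlim (fun h => f (t + h)) (at_right 0) (locally (f t)) ->
  filterlim (fun h => k (t + h)) (at_right 0) (locally (k t)) ->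
  filterlim (fun h => (f (t + h), k (t + h)) : X) (at_right 0) (locally ((f t, k t) : X)).
Proof.
intros hf hk. apply filterlim_locally. intro eps.
generalize (filter_and _ _ (proj1 (filterlim_locally _ _) hf eps)
  (proj1 (filterlim_locally (U := H) _ _) hk eps)).
apply filter_imp. intros h hh. exact hh.
Qed.

Let W t : X := (u t, u' t).
Let f t : X := wave_force gradF (u t, u' t).

Lemma phase_curve_right_continuous t : 0 <= t -> filterlim (fun h => W (t + h)) (at_right 0) (locally (W t)).
Proof.
intros _. apply phase_right_continuous.
- apply right_shift_lim, cu.
- exact (right_shift_lim (U := H) u' t (cu' t)).
Qed.

Lemma force_right_continuous t : 0 <= t -> filterlim (fun h => f (t + h)) (at_right 0) (locally (f t)).
Proof.
intros _.
apply (phase_right_continuous (fun _ => zero)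
  (fun s => minus (minus (incl (u s)) (g s)) (u' s))).
- exact (filterlim_const (U := dom_NormedModule B) _).
- apply (right_shift_lim (U := H) (fun s => minus (minus (incl (u s)) (g s)) (u' s))).
  refine (filterlim_vminus H _ _ _ _ _ (cu' t)).
  exact (filterlim_vminus H _ _ _ _ (continuous_incl t) (continuous_gradient_along t)).
Qed.

(** Symmetry of B gives <u, v> + <B u, B v> = <A u + u, v>; the summand u of the operator matches
    the |u|^2 of the graph norm. *)
Lemma wave_skew (x y : X) : wave_graph A x (opp y) -> inner x y = 0.
Proof.
destruct hsqrt as [_ [_ [hdom happ]]].
destruct x as [a b], y as [c d]. intros [h1 [h2 h3]]. simpl in h1, h2, h3.
change (opp (incl c) = opp b) in h2. change (opp d = plus (A (incl a)) (incl a)) in h3.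
assert (hcb : incl c = b).
{ apply inner_ext; intro z. apply (f_equal (fun w : H => inner w z)) in h2.
  rewrite !inner_opp_l in h2. lra. }
assert (hd : d = opp (plus (A (incl a)) (incl a))).
{ rewrite -h3. vec; ring. }
change (inner (incl a) (incl c) + inner (B (incl a)) (B (incl c)) + inner b d = 0).
rewrite -hcb hd inner_opp_r inner_plus_r happ; [|assumption].
destruct (proj1 (hdom _) h1) as [k1 k2].
rewrite -(sa_symmetric H B hB (incl c) (B (incl a))); [|apply incl_dom|assumption].
rewrite (inner_sym (B (incl c))) (inner_sym (incl c)). ring.
Qed.

Lemma phase_energy_right_deriv t : 0 <= t ->
  right_deriv (fun s => inner (W s) (W s)) t (2 * inner (minus (minus (incl (u t)) (g t)) (u' t)) (u' t)).
Proof.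
intro ht.
pose proof (mild_energy_right_deriv X _ E hE wave_skew W f force_right_continuous phase_curve_right_continuous hmild t ht) as h.
replace (2 * inner (minus (minus (incl (u t)) (g t)) (u' t)) (u' t)) with (2 * inner (f t) (W t));
  [exact h|].
f_equal.
change (inner (zero : H) (incl (u t)) + inner (B zero) (B (incl (u t))) +
  inner (minus (minus (incl (u t)) (g t)) (u' t)) (u' t) =
  inner (minus (minus (incl (u t)) (g t)) (u' t)) (u' t)).
rewrite op_zero !inner_zero_l. ring.
Qed.

Lemma norm_sq_right_deriv t : 0 <= t ->
  right_deriv (fun s => inner (incl (u s)) (incl (u s))) t (2 * inner (incl (u t)) (u' t)).
Proof.
intro ht. unfold right_deriv.
replace (2 * inner (incl (u t)) (u' t)) with
  (inner (u' t) (plus (incl (u t)) (incl (u t))))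
  by (rewrite inner_plus_r (inner_sym (u' t)); ring).
apply (filterlim_ext (fun h => inner (scal (/ h) (minus (incl (u (t + h))) (incl (u t))))
    (plus (incl (u (t + h))) (incl (u t))))).
- intro h. rewrite inner_scal_l inner_minus_l !inner_plus_r
    (inner_sym (incl (u (t + h))) (incl (u t))). unfold Rdiv; ring.
- refine (filterlim_inner H _ _ _ _ (du t ht) _).
  refine (filterlim_vplus H _ _ _ _ (right_shift_lim (U := H) _ t (continuous_incl t)) _).
  exact (filterlim_const (U := H) _).
Qed.

Let e t := norm (u' t) ^ 2 + norm (B (incl (u t))) ^ 2.

Lemma energy_inner t : e t = inner (W t) (W t) - inner (incl (u t)) (incl (u t)).
Proof.
unfold e. rewrite -!inner_norm.
change (inner (u' t) (u' t) + inner (B (incl (u t))) (B (incl (u t))) =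
  inner (incl (u t)) (incl (u t)) + inner (B (incl (u t))) (B (incl (u t)))
  + inner (u' t) (u' t) - inner (incl (u t)) (incl (u t))). ring.
Qed.

Lemma energy_continuous t : continuous e t.
Proof.
apply (continuous_ext (fun s => inner (u' s) (u' s) + inner (B (incl (u s))) (B (incl (u s))))).
- intro s. unfold e. now rewrite !inner_norm.
- apply (continuous_plus (V := R_NormedModule)); apply continuous_inner; (apply cu' || apply continuous_sqrt_along).
Qed.

(** Removing |u|^2 from |U|^2 cancels the auxiliary term u of [wave_force]. *)
Lemma energy_right_deriv t : 0 <= t ->
  right_deriv e t (- 2 * inner (g t) (u' t) - 2 * norm (u' t) ^ 2).
Proof.
intro ht.
pose proof (right_deriv_minus _ _ _ _ _ (phase_energy_right_deriv t ht) (norm_sq_right_deriv t ht)) as h.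
replace (- 2 * inner (g t) (u' t) - 2 * norm (u' t) ^ 2) with
  (2 * inner (minus (minus (incl (u t)) (g t)) (u' t)) (u' t) - 2 * inner (incl (u t)) (u' t))
  by (rewrite !inner_minus_l inner_norm; ring).
revert h. unfold right_deriv. apply filterlim_ext. intro h. now rewrite !energy_inner.
Qed.

Lemma potential_right_deriv t : 0 <= t ->
  right_deriv (fun s => F (u s)) t (inner (g t) (u' t)).
Proof.
intro ht.
set (w := fun h => scal (/ h) (minus (incl (u (t + h))) (incl (u t)))).
pose proof (filterlim_inner H (F := at_right 0) (fun _ => g t) w (g t) (u' t)
  (filterlim_const (U := H) _) (du t ht)) as h1.
apply (filterlim_locally (U := R_UniformSpace)). intro eps.
pose proof (proj1 (filterlim_locally _ _) h1 (pos_div_2 eps)) as k1.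
pose proof (proj1 (filterlim_norm_iff H _ _) (du t ht) 1 Rlt_0_1) as k2.
pose proof (norm_ge_0 (u' t)) as hu0.
(* Bounds the difference quotients [w h] in H for small h, which turns the relative remainder into
   eps/2. *)
set (K := norm (u' t) + 1).
assert (heta : 0 < eps / 2 / K).
{ apply Rdiv_lt_0_compat; [|unfold K; lra]. pose proof (cond_pos eps); lra. }
destruct (gradient_increment (u t) (eps / 2 / K) heta) as [d [hd h3]].
assert (k3 : at_right 0 (fun h => norm (minus (u (t + h)) (u t)) < d)).
{ exact (proj1 (filterlim_locally _ _) (right_shift_lim u t (cu t)) (mkposreal d hd)). }
assert (k4 : at_right 0 (fun h => 0 < h)) by (apply at_right_intro; exists 1; split; lra || (intros; lra)).
generalize (filter_and _ _ (filter_and _ _ k1 k2) (filter_and _ _ k3 k4)).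
apply filter_imp. intros h [[a b] [c hh]].
change (Rabs (inner (g t) (w h) - inner (g t) (u' t)) < eps / 2) in a.
change (Rabs ((F (u (t + h)) - F (u t)) / h - inner (g t) (u' t)) < eps).
specialize (h3 _ c). fold (g t) in h3.
set (dx := minus (incl (u (t + h))) (incl (u t))) in *.
assert (hw : norm (w h) <= K).
{ assert (e1 : w h = plus (u' t) (minus (w h) (u' t))) by (vec; ring).
  rewrite e1. eapply Rle_trans; [apply (norm_triangle (V := H))|].
  change (norm (minus (w h) (u' t)) < 1) in b. unfold K; lra. }
assert (hwd : norm (w h) = / h * norm dx).
{ unfold w. rewrite norm_scal_R Rabs_right; [reflexivity|].
  apply Rle_ge, Rlt_le, Rinv_0_lt_compat, hh. }
assert (hgw : inner (g t) (w h) = / h * inner (g t) dx) by (unfold w; apply inner_scal_r).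
set (r := F (u (t + h)) - F (u t) - inner (g t) dx) in h3.
assert (hr : Rabs (r / h) <= eps / 2).
{ unfold Rdiv at 1. rewrite Rabs_mult (Rabs_right (/ h)); [|apply Rle_ge, Rlt_le, Rinv_0_lt_compat, hh].
  assert (hi : 0 < / h) by (apply Rinv_0_lt_compat, hh).
  apply Rle_trans with (eps / 2 / K * norm (w h)).
  - rewrite hwd. apply (Rmult_le_compat_r (/ h)) in h3; [|lra].
    eapply Rle_trans; [exact h3|]. right; ring.
  - apply Rle_trans with (eps / 2 / K * K); [apply Rmult_le_compat_l; lra|].
    right; field; unfold K; lra. }
replace ((F (u (t + h)) - F (u t)) / h - inner (g t) (u' t)) with
  (r / h + (inner (g t) (w h) - inner (g t) (u' t)))
  by (rewrite hgw; unfold r; field; lra).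
eapply Rle_lt_trans; [apply Rabs_triang|]. lra.
Qed.

(** The vector (0, phi) lies in the domain of the generator, with image (phi, 0), for every phi in
    D(B). *)
Lemma weak_right_deriv phi t : dom B phi -> 0 <= t ->
  right_deriv (fun s => inner (u' s) phi) t
    (- inner (plus (g t) (u' t)) phi - inner (B (incl (u t))) (B phi)).
Proof.
intros hphi ht.
assert (hw : (fun x y : phase_space B => wave_graph A x (opp y)) (zero, phi) (MkDom hphi, zero)).
{ split; [apply dom_zero|]. split; [reflexivity|].
  change (opp (zero : H) = plus (A zero) zero). rewrite op_zero. vec; ring. }
pose proof (mild_weak_right_deriv X _ E hE wave_skew W f force_right_continuous hmild _ _ t hw ht) as h.
assert (hl : inner (f t) ((zero, phi) : X) - inner (W t) ((MkDom hphi, zero) : X) =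
  - inner (plus (g t) (u' t)) phi - inner (B (incl (u t))) (B phi)).
{ change (inner (zero : H) (zero : H) + inner (B zero) (B zero) +
    inner (minus (minus (incl (u t)) (g t)) (u' t)) phi -
    (inner (incl (u t)) phi + inner (B (incl (u t))) (B phi) + inner (u' t) (zero : H)) =
    - inner (plus (g t) (u' t)) phi - inner (B (incl (u t))) (B phi)).
  rewrite op_zero !inner_zero_l inner_zero_r !inner_minus_l inner_plus_l. ring. }
rewrite hl in h. revert h. unfold right_deriv. apply filterlim_ext. intro h.
change (inner (W (t + h)) ((zero, phi) : X)) with
  (inner (incl (u (t + h))) (zero : H) + inner (B (incl (u (t + h)))) (B zero) + inner (u' (t + h)) phi).
change (inner (W t) ((zero, phi) : X)) with
  (inner (incl (u t)) (zero : H) + inner (B (incl (u t))) (B zero) + inner (u' t) phi).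
rewrite op_zero !inner_zero_r. unfold Rdiv; ring.
Qed.

(** * The cross term <u', Q u> *)

Section Cross.
Variable Q : H -> H.
Hypotheses (hQlin : is_linear Q) (hQ : forall x y, inner (Q x) y = inner (Q x) (Q y))
  (hQdom : forall x, dom B x -> dom B (Q x) /\ B (Q x) = B x).

Let q t := Q (incl (u t)).

Lemma continuous_complement_along t : continuous (U := H) q t.
Proof.
exact (continuous_comp (V := H) (W := H) (fun s => incl (u s)) Q t (continuous_incl t) (linear_cont Q _ hQlin)).
Qed.

(** With phi frozen at [q (t + h)], the function <u'(s), phi> is differentiable in s, and the mean
    value theorem applies on [t, t + h]. *)
Lemma cross_mean_value t h : 0 <= t -> 0 < h -> exists c, t <= c <= t + h /\
  inner (minus (u' (t + h)) (u' t)) (q (t + h)) =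
  h * (- inner (plus (g c) (u' c)) (q (t + h)) - inner (B (incl (u c))) (B (incl (u (t + h))))).
Proof.
intros ht hh.
destruct (hQdom _ (incl_dom (u (t + h)))) as [hd hBq].
set (phi := q (t + h)).
set (df := fun s => - inner (plus (g s) (u' s)) phi - inner (B (incl (u s))) (B phi)).
assert (hder : forall s, 0 < s -> is_derive (fun s => inner (u' s) phi) s (df s)).
{ apply right_deriv_is_derive.
  - intro s. apply continuous_inner; [apply cu' | exact (continuous_const (V := H) _ _)].
  - intro s. apply (continuous_minus (V := R_NormedModule)).
    + apply (continuous_opp (V := R_NormedModule)). apply continuous_inner; [|exact (continuous_const (V := H) _ _)].
      exact (continuous_plus (V := H) _ _ s (continuous_gradient_along s) (cu' s)).
    + apply continuous_inner; [apply continuous_sqrt_along | exact (continuous_const (V := H) _ _)].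
  - intros s hs. now apply weak_right_deriv. }
destruct (MVT_gen (fun s => inner (u' s) phi) t (t + h) df) as [c [hc1 hc2]].
- intros s hs. rewrite Rmin_left in hs; [|lra]. apply hder; lra.
- intros s _. apply continuity_pt_filterlim. apply continuous_inner; [apply cu' | exact (continuous_const (V := H) _ _)].
- rewrite Rmin_left in hc1; [|lra]. rewrite Rmax_right in hc1; [|lra].
  exists c; split; [assumption|]. rewrite inner_minus_l hc2.
  replace (t + h - t) with h by ring. unfold df, phi, q. rewrite hBq. ring.
Qed.

(** Product rule on increments: the variation of u' is tested against [q (t + h)] by
    [cross_mean_value], and the variation of q against u'(t). *)
Lemma cross_right_deriv t : 0 <= t ->
  right_deriv (fun s => inner (u' s) (q s)) t
    (norm (Q (u' t)) ^ 2 - inner (u' t) (q t) - norm (B (incl (u t))) ^ 2 - inner (g t) (q t)).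
Proof.
intro ht.
set (mv := fun h c : R => t <= c <= t + h /\
  inner (minus (u' (t + h)) (u' t)) (q (t + h)) =
  h * (- inner (plus (g c) (u' c)) (q (t + h)) - inner (B (incl (u c))) (B (incl (u (t + h)))))).
(* Intermediate points for all h, arbitrary for h <= 0, so that [c] is a function, which tends to
   t. *)
assert (hc : forall h, exists c, 0 < h -> mv h c).
{ intro h. destruct (Rlt_le_dec 0 h) as [hh|hh].
  - destruct (cross_mean_value t h ht hh) as [c h']. now exists c.
  - exists 0. lra. }
set (c := fun h => proj1_sig (constructive_indefinite_description _ (hc h))).
assert (hc' : forall h, 0 < h -> mv h (c h))
  by (intro h; exact (proj2_sig (constructive_indefinite_description _ (hc h)))).
clearbody c.
assert (hclim : filterlim c (at_right 0) (locally t)).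
{ apply (filterlim_locally (U := R_UniformSpace)). intro eps. apply at_right_intro.
  exists eps; split; [apply cond_pos|]. intros h hh. destruct (hc' h) as [h1 _]; [lra|].
  change (Rabs (c h - t) < eps). apply Rabs_def1; lra. }
assert (hcomp : forall k : R -> H, continuous (U := H) k t ->
  filterlim (fun h => k (c h)) (at_right 0) (locally (k t))).
{ intros k hk. exact (filterlim_comp _ _ _ c k _ _ _ hclim hk). }
unfold right_deriv.
assert (hQd : filterlim (fun h => scal (/ h) (minus (q (t + h)) (q t))) (at_right 0) (locally (Q (u' t)))).
{ apply (filterlim_ext (fun h => Q (scal (/ h) (minus (incl (u (t + h))) (incl (u t)))))).
  - intro h. rewrite (linear_scal Q hQlin) (linear_minus Q); [reflexivity|assumption].
  - exact (filterlim_comp _ _ _ _ Q _ _ _ (du t ht) (linear_cont Q _ hQlin)). }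
replace (norm (Q (u' t)) ^ 2 - inner (u' t) (q t) - norm (B (incl (u t))) ^ 2 - inner (g t) (q t))
  with (plus (opp (inner (plus (g t) (u' t)) (q t)))
    (plus (opp (inner (B (incl (u t))) (B (incl (u t))))) (inner (u' t) (Q (u' t))))).
- apply (filterlim_ext_loc (fun h => plus (opp (inner (plus (g (c h)) (u' (c h))) (q (t + h))))
    (plus (opp (inner (B (incl (u (c h)))) (B (incl (u (t + h))))))
      (inner (u' t) (scal (/ h) (minus (q (t + h)) (q t))))))).
  + apply at_right_intro. exists 1; split; [lra|]. intros h hh. rewrite Rplus_0_l in hh.
    destruct (hc' h) as [_ h2]; [lra|].
    change (- inner (plus (g (c h)) (u' (c h))) (q (t + h)) +
      (- inner (B (incl (u (c h)))) (B (incl (u (t + h)))) +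
       inner (u' t) (scal (/ h) (minus (q (t + h)) (q t)))) =
      (inner (u' (t + h)) (q (t + h)) - inner (u' t) (q t)) / h).
    rewrite inner_scal_r inner_minus_r.
    rewrite inner_minus_l in h2.
    replace (inner (u' (t + h)) (q (t + h))) with
      (inner (u' t) (q (t + h)) + h * (- inner (plus (g (c h)) (u' (c h))) (q (t + h))
       - inner (B (incl (u (c h)))) (B (incl (u (t + h)))))) by lra.
    field; lra.
  + pose proof (right_shift_lim (U := H) q t (continuous_complement_along t)) as hq.
    pose proof (right_shift_lim (U := H) (fun s => B (incl (u s))) t (continuous_sqrt_along t)) as hb.
    assert (hopp : forall (k : R -> R) l, filterlim k (at_right 0) (locally l) ->
      filterlim (fun h => opp (k h)) (at_right 0) (locally (opp l))).
    { intros k l hk. exact (filterlim_comp _ _ _ k opp _ _ _ hk (filterlim_opp (V := R_NormedModule) l)). }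
    refine (filterlim_comp_2 _ _ plus (hopp _ _ _) _ (filterlim_plus (V := R_NormedModule) _ _)).
    * refine (filterlim_inner H _ _ _ _ _ hq).
      exact (filterlim_vplus H _ _ _ _ (hcomp g (continuous_gradient_along t)) (hcomp u' (cu' t))).
    * refine (filterlim_comp_2 _ _ plus (hopp _ _ _) _ (filterlim_plus (V := R_NormedModule) _ _)).
      -- exact (filterlim_inner H _ _ _ _ (hcomp _ (continuous_sqrt_along t)) hb).
      -- exact (filterlim_inner H _ _ _ _ (filterlim_const (U := H) _) hQd).
- change (- inner (plus (g t) (u' t)) (q t) + (- inner (B (incl (u t))) (B (incl (u t)))
    + inner (u' t) (Q (u' t))) = norm (Q (u' t)) ^ 2 - inner (u' t) (q t)
    - norm (B (incl (u t))) ^ 2 - inner (g t) (q t)).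
  rewrite -!inner_norm inner_plus_l -(hQ (u' t) (u' t)) (inner_sym (Q (u' t))). ring.
Qed.

End Cross.

Lemma total_energy_right_deriv t : 0 <= t ->
  right_deriv (fun s => e s + 2 * F (u s)) t (- 2 * norm (u' t) ^ 2).
Proof.
intro ht.
pose proof (right_deriv_minus _ _ _ _ _ (right_deriv_minus _ _ _ _ _ (energy_right_deriv t ht)
  (right_deriv_opp _ _ _ (potential_right_deriv t ht)))
  (right_deriv_opp _ _ _ (potential_right_deriv t ht))) as h.
replace (- 2 * norm (u' t) ^ 2) with (- 2 * inner (g t) (u' t) - 2 * norm (u' t) ^ 2
  - - inner (g t) (u' t) - - inner (g t) (u' t)) by ring.
revert h. unfold right_deriv. apply filterlim_ext. intro h. unfold Rdiv; ring.
Qed.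

Lemma total_energy_nonincreasing t : 0 <= t -> e t + 2 * F (u t) <= e 0 + 2 * F (u 0).
Proof.
assert (cF : forall s, continuous (fun r => F (u r)) s).
{ intro s. exact (continuous_comp u F s (cu s) (potential_continuous (u s))). }
assert (ce : forall s, continuous (fun s => e s + 2 * F (u s)) s).
{ intro s. apply (continuous_plus (V := R_NormedModule)); [apply energy_continuous|].
  apply (continuous_mult (fun _ => 2)); [apply continuous_const | apply cF]. }
apply (nonincreasing_of_derive (fun s => e s + 2 * F (u s)) (fun s => - 2 * inner (u' s) (u' s))).
- exact ce.
- apply right_deriv_is_derive.
  + exact ce.
  + intro s. apply (continuous_mult (fun _ => - 2)); [apply continuous_const|].
    apply continuous_inner; apply cu'.
  + intros s hs. rewrite inner_norm. now apply total_energy_right_deriv.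
- intros s hs. rewrite inner_norm. pose proof (pow2_ge_0 (norm (u' s))). lra.
Qed.

(** * The corrected energy and its differential inequality *)

Section Decay.
Variables (Q : H -> H) (nu p rho R0 alpha delta K ez sigma : R).
Hypotheses (hQlin : is_linear Q) (hQ : forall x y, inner (Q x) y = inner (Q x) (Q y))
  (hQdom : forall x, dom B x -> dom B (Q x) /\ B (Q x) = B x)
  (hQgap : forall x, dom B x -> nu * norm (Q x) ^ 2 <= norm (B x) ^ 2).
Hypotheses (hnu : 0 < nu) (hp : 0 < p) (hrho : 0 < rho) (hR0 : 0 < R0) (halpha : 0 < alpha).
Hypothesis hgrowth : forall x : dom_space B, norm x <= rho ->
  norm (gradF x) <= R0 * (rpow (norm (incl x)) (p + 1) + rpow (norm (B (incl x))) (1 + alpha)).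
Hypothesis hFpos : forall x, 0 <= F x.
Hypothesis hdelta : delta = nu / (4 * (nu + 1)).
Hypothesis hK : K = 2 * (6 * R0 ^ 2) / (delta / 4).
Hypotheses (hez : 0 < ez <= rho ^ 2 / 2)
  (hez' : 2 * K * (p + 1) * sqrt (2 * K) * Rpower ez (p / 2) < 6 * R0 ^ 2).
(** Together with the bound on [ez], [hs1] keeps the graph norm below rho; [hs2] lets the
    dissipation absorb the |B u| term of the growth condition; [hs3] gives the unconditional bound
    on Phi required by the barrier. *)
Hypotheses (hs1 : sigma <= rho ^ 2 / 2)
  (hs2 : sigma <= Rpower (delta / (12 * R0 ^ 2)) (1 / (2 * alpha)) ^ 2)
  (hs3 : sigma <= K * Rpower ez (p + 1) / 2).
Hypothesis hinit : e 0 + 2 * F (u 0) < sigma.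
Hypotheses (hz0 : incl (u 0) <> zero)
  (he0 : 2 * e 0 < K * Rpower (norm (incl (u 0)) ^ 2) (p + 1)).

Let q t := Q (incl (u t)).
Let z t := norm (incl (u t)) ^ 2.
Let Phi t := e t + 2 * delta * inner (u' t) (q t).

(** The identity in the middle determines delta: its left side is the share of |u'|^2 that the cross
    term consumes. *)
Lemma delta_bounds : 0 < delta <= 1 / 4 /\ 2 * delta + 2 * (delta / nu) = 1 / 2 /\ 0 < delta / nu.
Proof.
rewrite hdelta. split; [split|split].
- apply Rdiv_lt_0_compat; lra.
- apply Rle_div_l; lra.
- field; lra.
- apply Rdiv_lt_0_compat; [apply Rdiv_lt_0_compat; lra | lra].
Qed.

(** By the gap |Q u|^2 <= |B u|^2 / nu, and delta is small enough for the cross term to be at most e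
    / 2. *)
Lemma corrected_energy_equiv t : e t / 2 <= Phi t <= 2 * e t.
Proof.
destruct delta_bounds as [h1 [h2 h3]].
pose proof (inner_Cauchy_Schwarz H (u' t) (q t)) as hcs. apply Rabs_le_between in hcs.
pose proof (hQgap _ (incl_dom (u t))) as hg. fold (q t) in hg.
unfold Phi, e. set (a := norm (u' t)) in *. set (b := norm (B (incl (u t)))) in *.
set (n := norm (q t)) in *.
assert (ha : 0 <= a) by apply norm_ge_0. assert (hn : 0 <= n) by apply norm_ge_0.
assert (hb2 : 0 <= b ^ 2) by apply pow2_ge_0.
assert (hx : 2 * delta * (a * n) <= a ^ 2 / 2 + 2 * delta ^ 2 * n ^ 2).
{ pose proof (pow2_ge_0 (a - 2 * delta * n)). nra. }
assert (hy : delta ^ 2 * n ^ 2 <= b ^ 2 / 4).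
{ assert (hnb : n ^ 2 <= b ^ 2 / nu) by (apply (proj1 (Rle_div_r _ _ _ hnu)); lra).
  apply Rle_trans with (delta * (delta / nu) * b ^ 2).
  - replace (delta * (delta / nu) * b ^ 2) with (delta ^ 2 * (b ^ 2 / nu)) by (field; lra).
    apply Rmult_le_compat_l; [apply pow2_ge_0 | assumption].
  - assert (delta * (delta / nu) <= 1 / 4) by nra. nra. }
split; nra.
Qed.

(** Read a = |u'|, b = |B u|, n = |Q u|, gn = |grad F|, qu = |Q u'|, and i, iu, ig for <grad F, u'>,
    <u', Q u>, <grad F, Q u>. Young: of - 2 a^2, one a^2/2 pays for i and another for qu and iu; of
    - 2 delta b^2, half pays for iu and ig through the gap. *)
Lemma corrected_energy_derivative_bound (a b n gn qu iu ig i : R) :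
  0 <= a -> 0 <= n -> 0 <= gn -> nu * n ^ 2 <= b ^ 2 -> qu ^ 2 <= a ^ 2 ->
  - (gn * a) <= i -> - (a * n) <= iu -> - (gn * n) <= ig ->
  - 2 * i - 2 * a ^ 2 + 2 * delta * (qu ^ 2 - iu - b ^ 2 - ig) <=
  - delta * (a ^ 2 + b ^ 2) + 3 * gn ^ 2.
Proof.
intros ha hn hgn hnb hq hi hiu hig.
destruct delta_bounds as [h1 [h2 h3]].
set (dn := delta / nu) in *.
assert (hdn : delta = dn * nu) by (unfold dn; field; lra).
assert (k1 : 2 * (gn * a) <= a ^ 2 / 2 + 2 * gn ^ 2).
{ pose proof (pow2_ge_0 (a - 2 * gn)). nra. }
assert (k2 : 2 * delta * (a * n) <= 2 * dn * a ^ 2 + delta * b ^ 2 / 2).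
{ assert (2 * delta * (a * n) <= 2 * dn * a ^ 2 + delta * (nu * n ^ 2) / 2).
  { rewrite hdn. pose proof (pow2_ge_0 (2 * a - nu * n)). nra. }
  nra. }
assert (k3 : 2 * delta * (gn * n) <= 2 * dn * gn ^ 2 + delta * b ^ 2 / 2).
{ assert (2 * delta * (gn * n) <= 2 * dn * gn ^ 2 + delta * (nu * n ^ 2) / 2).
  { rewrite hdn. pose proof (pow2_ge_0 (2 * gn - nu * n)). nra. }
  nra. }
assert (k4 : 2 * delta * qu ^ 2 <= 2 * delta * a ^ 2) by nra.
assert (k5 : - (2 * delta * iu) <= 2 * delta * (a * n)) by nra.
assert (k6 : - (2 * delta * ig) <= 2 * delta * (gn * n)) by nra.
pose proof (pow2_ge_0 a) as ha2. pose proof (pow2_ge_0 gn) as hg2.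
assert (k7 : (2 * delta + 2 * dn) * a ^ 2 = 1 / 2 * a ^ 2) by (rewrite h2; ring).
assert (k8 : 2 * dn * gn ^ 2 <= gn ^ 2) by nra.
assert (k9 : delta * a ^ 2 <= a ^ 2) by nra.
lra.
Qed.

Lemma energy_small t : 0 <= t -> e t < sigma.
Proof.
intro ht. pose proof (total_energy_nonincreasing t ht). pose proof (hFpos (u t)). lra.
Qed.

(** The constant 6 R0^2 is 3 times the factor 2 R0^2 from squaring a sum of two terms. *)
Lemma force_bound t : 0 <= t -> 0 < z t <= ez ->
  3 * norm (g t) ^ 2 <= delta / 2 * e t + 6 * R0 ^ 2 * Rpower (z t) (p + 1).
Proof.
intros ht [hz hze]. destruct delta_bounds as [h1 _].
pose proof (energy_small t ht) as he.
pose proof (pow2_ge_0 (norm (u' t))) as ha2.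
set (b := norm (B (incl (u t)))). assert (hb : 0 <= b) by apply norm_ge_0.
set (n := norm (incl (u t))). assert (hn : 0 <= n) by apply norm_ge_0.
assert (hbe : b ^ 2 <= e t) by (unfold e, b; lra).
assert (hrh : norm (u t) <= rho).
{ apply Rsqr_incr_0_var; [|lra]. rewrite !Rsqr_pow2.
  change (dnorm (u t) ^ 2 <= rho ^ 2). rewrite dnorm_sq. fold n b.
  unfold z in hze. fold n in hze. lra. }
pose proof (hgrowth (u t) hrh) as hgr. fold (g t) n b in hgr.
set (x := rpow n (p + 1)) in *. set (y := rpow b (1 + alpha)) in *.
assert (hn0 : 0 < n).
{ unfold z in hz. fold n in hz. destruct (Req_dec n 0) as [h|h]; [rewrite h in hz; lra | lra]. }
assert (hx : x ^ 2 = Rpower (z t) (p + 1)).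
{ unfold x, rpow. destruct (Rle_dec n 0); [lra|]. unfold z. fold n.
  rewrite -!(Rpower_pow 2); [|assumption|apply Rpower_pos].
  rewrite !Rpower_mult. f_equal. ring. }
(* The bound b <= beta means b^(2 alpha) <= delta / (12 R0^2), which converts b^(2 + 2 alpha) into a
   small multiple of b^2. *)
assert (hy : 6 * R0 ^ 2 * y ^ 2 <= delta / 2 * b ^ 2).
{ unfold y, rpow. destruct (Rle_dec b 0) as [hb0|hb0].
  - pose proof (pow2_ge_0 b). nra.
  - set (beta := Rpower (delta / (12 * R0 ^ 2)) (1 / (2 * alpha))) in *.
    assert (hbeta : 0 < beta) by apply Rpower_pos.
    assert (hbb : b <= beta).
    { apply Rsqr_incr_0_var; [|lra]. rewrite !Rsqr_pow2. lra. }
    assert (hR2 : 0 < 12 * R0 ^ 2) by nra.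
    assert (hpw : Rpower b (2 * alpha) <= delta / (12 * R0 ^ 2)).
    { replace (delta / (12 * R0 ^ 2)) with (Rpower beta (2 * alpha)).
      - apply Rle_Rpower_l; lra.
      - unfold beta. rewrite Rpower_mult.
        replace (1 / (2 * alpha) * (2 * alpha)) with 1 by (field; lra).
        apply Rpower_1. apply Rdiv_lt_0_compat; lra. }
    assert (hsq : Rpower b (1 + alpha) ^ 2 = b ^ 2 * Rpower b (2 * alpha)).
    { rewrite Rpower_plus Rpower_1; [|lra].
      replace (2 * alpha) with (alpha + alpha) by ring. rewrite Rpower_plus. ring. }
    rewrite hsq.
    apply Rle_trans with (6 * R0 ^ 2 * (b ^ 2 * (delta / (12 * R0 ^ 2)))).
    + apply Rmult_le_compat_l; [nra|]. apply Rmult_le_compat_l; [nra | assumption].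
    + right. field. lra. }
assert (hxy : norm (g t) ^ 2 <= (R0 * (x + y)) ^ 2).
{ apply pow_incr. split; [apply norm_ge_0 | assumption]. }
assert (hsum : (R0 * (x + y)) ^ 2 <= 2 * R0 ^ 2 * x ^ 2 + 2 * R0 ^ 2 * y ^ 2).
{ pose proof (pow2_ge_0 (R0 * (x - y))). nra. }
rewrite -hx. nra.
Qed.

Lemma slow_decay t : 0 <= t ->
  0 < z t /\ Rpower (z t) (- p / 2) <= Rpower (z 0) (- p / 2) + p * sqrt (2 * K) * t.
Proof.
destruct delta_bounds as [hd1 [hd2 hd3]].
assert (hR2 : 0 < R0 ^ 2) by nra.
assert (hz_pos : forall s, 0 <= z s) by (intro; apply pow2_ge_0).
assert (he_pos : forall s, 0 <= e s).
{ intro s. unfold e. pose proof (pow2_ge_0 (norm (u' s))).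
  pose proof (pow2_ge_0 (norm (B (incl (u s))))). lra. }
assert (cz : forall s, continuous z s).
{ intro s. apply (continuous_ext (fun s => inner (incl (u s)) (incl (u s)))).
  - intro r. apply inner_norm.
  - apply continuous_inner; apply continuous_incl. }
assert (cPhi : forall s, continuous Phi s).
{ intro s. apply (continuous_plus (V := R_NormedModule)); [apply energy_continuous|].
  apply (continuous_mult (fun _ => 2 * delta)); [apply continuous_const|].
  apply continuous_inner; [apply cu' | now apply continuous_complement_along]. }
set (Phi' := fun s => - 2 * inner (g s) (u' s) - 2 * norm (u' s) ^ 2 +
  2 * delta * (norm (Q (u' s)) ^ 2 - inner (u' s) (q s) - norm (B (incl (u s))) ^ 2 - inner (g s) (q s))).
assert (dz : forall s, 0 < s -> is_derive z s (2 * inner (incl (u s)) (u' s))).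
{ apply (right_deriv_is_derive z (fun s => 2 * inner (incl (u s)) (u' s))); [exact cz| |].
  - intro s. apply (continuous_mult (fun _ => 2)); [apply continuous_const|].
    apply continuous_inner; [apply continuous_incl | apply cu'].
  - intros s hs. pose proof (norm_sq_right_deriv s hs) as h. revert h.
    unfold right_deriv. apply filterlim_ext. intro r. unfold z. now rewrite !inner_norm. }
assert (dPhi : forall s, 0 < s -> is_derive Phi s (Phi' s)).
{ assert (hQu' : forall s, continuous (U := H) (fun s => Q (u' s)) s).
  { intro s. exact (continuous_comp (V := H) (W := H) u' Q s (cu' s) (linear_cont Q _ hQlin)). }
  apply (right_deriv_is_derive Phi Phi'); [exact cPhi| |].
  - intro s. apply (continuous_ext (fun s => - 2 * inner (g s) (u' s) - 2 * inner (u' s) (u' s) +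
      2 * delta * (inner (Q (u' s)) (Q (u' s)) - inner (u' s) (q s)
        - inner (B (incl (u s))) (B (incl (u s))) - inner (g s) (q s)))).
    + intro r. unfold Phi'. now rewrite !inner_norm.
    + assert (hm : forall (c : R) (k : R -> R), continuous k s -> continuous (fun r => c * k r) s).
      { intros c k hk. apply (continuous_mult (fun _ => c)); [apply continuous_const | exact hk]. }
      assert (hcq := continuous_complement_along Q hQlin s).
      apply (continuous_plus (V := R_NormedModule)).
      * apply (continuous_minus (V := R_NormedModule)); apply hm; apply continuous_inner;
          solve [apply continuous_gradient_along | apply cu'].
      * apply hm.
        apply (continuous_minus (V := R_NormedModule));
          [apply (continuous_minus (V := R_NormedModule));
            [apply (continuous_minus (V := R_NormedModule))|]|];
          apply continuous_inner; solve [apply hQu' | apply cu' | exact hcq | apply continuous_sqrt_along | apply continuous_gradient_along].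
  - intros s hs. unfold Phi'.
    pose proof (energy_right_deriv s hs) as h1.
    pose proof (cross_right_deriv Q hQlin hQ hQdom s hs) as h2.
    fold (q s) in h2. unfold right_deriv in h1, h2 |- *.
    apply (filterlim_ext (fun h => plus ((e (s + h) - e s) / h)
      (scal (2 * delta) ((inner (u' (s + h)) (q (s + h)) - inner (u' s) (q s)) / h)))).
    + intro h. change ((e (s + h) - e s) / h +
        2 * delta * ((inner (u' (s + h)) (q (s + h)) - inner (u' s) (q s)) / h) =
        (Phi (s + h) - Phi s) / h). unfold Phi, Rdiv; ring.
    + refine (filterlim_comp_2 _ _ plus h1 _ (filterlim_plus (V := R_NormedModule) _ _)).
      exact (filterlim_comp _ _ _ _ (scal (2 * delta)) _ _ _ h2
        (filterlim_scal_r (V := R_NormedModule) (2 * delta) _)). }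
(* The rate delta / 4: [force_bound] leaves half of the dissipation delta * e, and Phi <= 2 e. *)
apply (barrier Phi Phi' z (fun s => 2 * inner (incl (u s)) (u' s)) p (delta / 4)
  (6 * R0 ^ 2) K ez hp ltac:(lra) ltac:(lra) (proj1 hez) hK hez' cPhi cz dPhi dz).
- intros s hs. rewrite Rabs_mult (Rabs_right 2); [|lra].
  apply Rmult_le_compat_l; [lra|].
  eapply Rle_trans; [apply inner_Cauchy_Schwarz|].
  unfold z. rewrite sqrt_pow2; [|apply norm_ge_0].
  apply Rmult_le_compat_l; [apply norm_ge_0|].
  rewrite -(sqrt_pow2 (norm (u' s))); [|apply norm_ge_0].
  apply sqrt_le_1_alt. pose proof (corrected_energy_equiv s) as h.
  pose proof (pow2_ge_0 (norm (B (incl (u s))))). unfold e in h at 1. lra.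
- intros s hs hzs.
  pose proof (force_bound s ltac:(lra) hzs) as hf.
  pose proof (corrected_energy_equiv s) as heq.
  assert (hmain : Phi' s <= - delta * (norm (u' s) ^ 2 + norm (B (incl (u s))) ^ 2)
    + 3 * norm (g s) ^ 2).
  { unfold Phi'. apply (corrected_energy_derivative_bound _ _ (norm (q s))); try apply norm_ge_0.
    - apply hQgap, incl_dom.
    - rewrite -inner_norm -hQ.
      pose proof (hQ (u' s) (u' s)) as hh. rewrite inner_norm in hh.
      pose proof (inner_le H (Q (u' s)) (u' s)).
      pose proof (norm_ge_0 (Q (u' s))). pose proof (norm_ge_0 (u' s)).
      destruct (Req_dec (norm (Q (u' s))) 0); nra.
    - pose proof (inner_Cauchy_Schwarz H (g s) (u' s)) as h. apply Rabs_le_between in h. lra.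
    - pose proof (inner_Cauchy_Schwarz H (u' s) (q s)) as h. apply Rabs_le_between in h. lra.
    - pose proof (inner_Cauchy_Schwarz H (g s) (q s)) as h. apply Rabs_le_between in h. lra. }
  fold (e s) in hmain. pose proof (he_pos s). nra.
- intros s hs. pose proof (energy_small s hs). pose proof (corrected_energy_equiv s). lra.
- unfold z. assert (hn0 : norm (incl (u 0)) <> 0).
  { intro h. apply hz0. exact (norm_eq_zero (V := H) _ h). }
  pose proof (norm_ge_0 (incl (u 0))). nra.
- pose proof (corrected_energy_equiv 0). unfold z. lra.
Qed.

End Decay.

End Derivatives.

(** * The open set of data and the lower bound *)

Lemma continuous_on_extend {U : UniformSpace} (f : R -> U) t :
  continuous_on (Rle 0) f -> continuous (fun s => f (Rmax 0 s)) t.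
Proof.
intro h.
refine (filterlim_comp _ _ _ (Rmax 0) f _ _ _ _ (h (Rmax 0 t) (Rmax_l 0 t))).
intros P [d hP]. exists d. intros s hs. apply hP; [|apply Rmax_l].
change (Rabs (s - t) < d) in hs. change (Rabs (Rmax 0 s - Rmax 0 t) < d).
apply Rabs_def2 in hs. unfold Rmax; repeat destruct (Rle_dec _ _); apply Rabs_def1; lra.
Qed.

Lemma locally_continuous_lt {U : UniformSpace} (f : U -> R) (x : U) (c : R) :
  continuous f x -> f x < c -> locally x (fun y => f y < c).
Proof.
intros hf hc. assert (he : 0 < c - f x) by lra.
generalize (proj1 (filterlim_locally _ _) hf (mkposreal _ he)). apply filter_imp.
intros y hy. change (Rabs (f y - f x) < c - f x) in hy. apply Rabs_def2 in hy. lra.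
Qed.

(** Raising the linear bound on z^(-p/2) to the power -1/p; this is where M3 = N^(-1/p) comes
    from. *)
Lemma Rpower_inverse_bound (zt N p t : R) :
  0 < p -> 0 < zt -> 0 < N -> 0 <= t ->
  Rpower zt (- p / 2) <= N * (1 + t) ->
  Rpower N (- (1 / p)) / Rpower (1 + t) (1 / p) <= sqrt zt.
Proof.
intros hp hz hN ht h.
rewrite -(Rpower_sqrt zt hz).
replace (/ 2) with ((- p / 2) * (- (1 / p))) by (field; lra).
rewrite -Rpower_mult. unfold Rdiv at 1. rewrite -Rpower_Ropp Rpower_mult_distr; [|lra|lra].
rewrite !Rpower_Ropp. apply Rinv_le_contravar; [apply Rpower_pos|].
apply Rle_Rpower_l; [|split; [apply Rpower_pos | assumption]].
apply Rlt_le, Rdiv_lt_0_compat; lra.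
Qed.

Theorem theorem2p3 (H : Hilbert) (A sqrtA : linear_op H)
    (hA : self_adjoint A) (hA0 : nonnegative A) (hsqrt : is_op_sqrt A sqrtA)
    (F : dom_space sqrtA -> R) (gradF : dom_space sqrtA -> H)
    (hF : forall u, 0 <= F u) (hF0 : F zero = 0)
    (hgrad : is_gradient F gradF) (hlip : locally_lipschitz gradF)
    (hker : exists w : H, in_ker A w /\ w <> zero)
    (hgap : exists nu : R, 0 < nu /\
       forall u : H, dom sqrtA u -> in_ker_orth A u ->
         nu * norm u ^ 2 <= norm (sqrtA u) ^ 2)
    (p : R) (hp : 0 < p)
    (hgrowth : exists rho R0 alpha : R, 0 < rho /\ 0 < R0 /\ 0 < alpha /\
       forall u : dom_space sqrtA, norm u <= rho ->
         norm (gradF u) <=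
           R0 * (rpow (norm (incl u)) (p + 1)
                 + rpow (norm (sqrtA (incl u))) (1 + alpha))) :
  exists (S : phase_space sqrtA -> Prop) (M3 : R),
    (exists x, S x) /\ open S /\ 0 < M3 /\
    forall (u0 : dom_space sqrtA) (u1 : H), S (u0, u1) ->
    forall u : R -> dom_space sqrtA,
      global_weak_solution A gradF u0 u1 u ->
      forall t : R, 0 <= t ->
        M3 / Rpower (1 + t) (1 / p) <= norm (incl (u t)).
Proof.
destruct hgap as [nu [hnu hgap']].
destruct hgrowth as [rho [R0 [alpha [hrho [hR0 [halpha hgr]]]]]].
destruct hker as [w [hw hw0]].
destruct (kernel_complement_exists H A sqrtA hsqrt) as [Q [hQlin [hQ [hQorth hQdom]]]].
assert (hQgap : forall x, dom sqrtA x -> nu * norm (Q x) ^ 2 <= norm (sqrtA x) ^ 2).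
{ intros x hx. destruct (hQdom x hx) as [h1 h2]. rewrite -h2. now apply hgap'. }
set (delta := nu / (4 * (nu + 1))).
assert (hdelta : 0 < delta) by (apply Rdiv_lt_0_compat; lra).
assert (hR2 : 0 < R0 ^ 2) by nra.
set (K := 2 * (6 * R0 ^ 2) / (delta / 4)).
assert (hK : 0 < K) by (apply Rdiv_lt_0_compat; lra).
set (M := 2 * K * (p + 1) * sqrt (2 * K)).
assert (hM : 0 < M).
{ apply Rmult_lt_0_compat; [apply Rmult_lt_0_compat; lra | apply sqrt_lt_R0; lra]. }
(* The second entry makes M * ez^(p/2) at most 3 R0^2, half of what the barrier allows. *)
set (ez := Rmin (rho ^ 2 / 2) (Rpower (6 * R0 ^ 2 / (2 * M)) (2 / p))).
assert (hrho2 : 0 < rho ^ 2) by nra.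
assert (hez : 0 < ez <= rho ^ 2 / 2).
{ split; [apply Rmin_glb_lt; [lra | apply Rpower_pos] | apply Rmin_l]. }
assert (hez' : M * Rpower ez (p / 2) < 6 * R0 ^ 2).
{ assert (hq : 0 < 6 * R0 ^ 2 / (2 * M)) by (apply Rdiv_lt_0_compat; lra).
  assert (h : Rpower ez (p / 2) <= 6 * R0 ^ 2 / (2 * M)).
  { apply Rle_trans with (Rpower (Rpower (6 * R0 ^ 2 / (2 * M)) (2 / p)) (p / 2)).
    - apply Rle_Rpower_l; [lra|]. split; [lra | apply Rmin_r].
    - rewrite Rpower_mult. replace (2 / p * (p / 2)) with 1 by (field; lra).
      rewrite Rpower_1; lra. }
  apply (Rmult_le_compat_l M) in h; [|lra].
  replace (M * (6 * R0 ^ 2 / (2 * M))) with (3 * R0 ^ 2) in h by (field; lra). lra. }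
set (beta := Rpower (delta / (12 * R0 ^ 2)) (1 / (2 * alpha))).
assert (hbeta : 0 < beta ^ 2) by (apply pow_lt, Rpower_pos).
set (sigma := Rmin (rho ^ 2 / 2) (Rmin (beta ^ 2) (K * Rpower ez (p + 1) / 2))).
assert (hKez : 0 < K * Rpower ez (p + 1) / 2).
{ pose proof (Rpower_pos ez (p + 1)). assert (0 < K * Rpower ez (p + 1)) by nra. lra. }
assert (hsigma : 0 < sigma) by (repeat apply Rmin_glb_lt; lra).
assert (hs1 : sigma <= rho ^ 2 / 2) by apply Rmin_l.
assert (hs2 : sigma <= beta ^ 2) by (eapply Rle_trans; [apply Rmin_r | apply Rmin_l]).
assert (hs3 : sigma <= K * Rpower ez (p + 1) / 2)
  by (eapply Rle_trans; [apply Rmin_r | apply Rmin_r]).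
pose proof (potential_continuous H sqrtA F gradF hgrad) as cF.
assert (hF4 : locally (zero : dom_space sqrtA) (fun y => F y < sigma / 4))
  by (apply locally_continuous_lt; [apply cF | rewrite hF0; lra]).
destruct hF4 as [d hd].
set (r := d / 2).
assert (hr : 0 < r) by (pose proof (cond_pos d); unfold r; lra).
apply (in_ker_sqrt H A sqrtA hsqrt) in hw. destruct hw as [hwd hw1].
assert (hwn : 0 < norm w).
{ destruct (Rle_lt_or_eq_dec _ _ (norm_ge_0 w)) as [|h]; [assumption|].
  exfalso; apply hw0. exact (norm_eq_zero (V := H) w (eq_sym h)). }
(* On the kernel the graph norm is the norm of H, so this multiple of w has graph norm r < d and F
   is below sigma / 4 there. *)
set (x0 := MkDom (dom_scal (r / norm w) hwd) : dom_space sqrtA).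
assert (hx0 : norm (incl x0) = r).
{ simpl. rewrite norm_scal_R Rabs_right; [field; lra|].
  apply Rle_ge, Rlt_le, Rdiv_lt_0_compat; lra. }
assert (hBx0 : sqrtA (incl x0) = zero).
{ simpl. rewrite app_scal; [|assumption]. rewrite hw1. exact (scal_zero_r (V := H) _). }
assert (hFx0 : F x0 < sigma / 4).
{ apply hd. change (dnorm (minus x0 zero) < d).
  assert (e : minus x0 zero = x0) by exact (minus_zero_r (G := dom_NormedModule sqrtA) x0).
  rewrite e. eapply Rle_lt_trans; [apply dnorm_le|].
  rewrite hx0 hBx0 (norm_zero (V := H)). unfold r. pose proof (cond_pos d). lra. }
set (k0 := K * Rpower ((r / 2) ^ 2) (p + 1)).
assert (hk0 : 0 < k0) by (pose proof (Rpower_pos ((r / 2) ^ 2) (p + 1)); unfold k0; nra).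
(* The first entry gives e + 2 F < sigma / 2 + 2 * (sigma / 4) = sigma; the second puts the data
   inside the region, as 2 e < k0 <= K |u0|^(2p+2) when |u0| > r / 2. *)
set (kappa := Rmin (sigma / 2) (k0 / 2)).
assert (hkappa : 0 < kappa) by (apply Rmin_glb_lt; lra).
set (en := fun x : phase_space sqrtA =>
  inner (snd x : H) (snd x) + inner (sqrtA (incl (fst x))) (sqrtA (incl (fst x)))).
set (P := fun x : phase_space sqrtA =>
  - norm (incl (fst x)) < - (r / 2) /\ en x < kappa /\ F (fst x) < sigma / 4).
set (Y := Rpower ((r / 2) ^ 2) (- p / 2)).
(* Chosen so that Y + p sqrt(2 K) t <= N (1 + t). *)
set (N := Y + p * sqrt (2 * K)).
assert (hY : 0 < Y) by apply Rpower_pos.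
assert (hcK : 0 <= p * sqrt (2 * K)) by (apply Rmult_le_pos; [lra | apply sqrt_pos]).
(* Taking the interior of P makes openness immediate; (x0, 0) belongs to it by continuity of the
   three functions defining P. *)
exists (fun x => locally x P), (Rpower N (- (1 / p))).
split; [|split; [|split]].
- exists (x0, zero).
  assert (cfst : continuous (fun x : phase_space sqrtA => fst x) (x0, zero : H))
    by exact (continuous_fst (V := H) x0 zero).
  assert (csnd : continuous (U := H) (fun x : phase_space sqrtA => snd x : H) (x0, zero : H))
    by exact (continuous_snd (V := H) x0 zero).
  destruct (proj1 (filterlim_dom_iff H sqrtA (fun x : phase_space sqrtA => fst x) x0) cfst)
    as [cincl capp].
  apply filter_and; [|apply filter_and].
  + apply (locally_continuous_lt (fun x : phase_space sqrtA => - norm (incl (fst x)))).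
    * apply (continuous_opp (V := R_NormedModule) (fun x : phase_space sqrtA => norm (incl (fst x)))).
      exact (filterlim_comp _ _ _ _ norm _ _ _ cincl (filterlim_norm (V := H) _)).
    * change (- norm (incl x0) < - (r / 2)). rewrite hx0. lra.
  + apply (locally_continuous_lt en).
    * apply (continuous_plus (V := R_NormedModule)).
      -- exact (filterlim_inner H _ _ _ _ csnd csnd).
      -- exact (filterlim_inner H _ _ _ _ capp capp).
    * change (inner (zero : H) (zero : H) + inner (sqrtA (incl x0)) (sqrtA (incl x0)) < kappa).
      rewrite hBx0 inner_zero_l. lra.
  + apply (locally_continuous_lt (fun x : phase_space sqrtA => F (fst x))); [|exact hFx0].
    exact (continuous_comp (fun x : phase_space sqrtA => fst x) F _ cfst (cF x0)).
- intros x hx. now apply locally_locally.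
- apply Rpower_pos.
- intros u0 u1 hS u [cu [u' [du [cu' [hu0 [hu1 [E [hE hmild]]]]]]]] t ht.
  apply locally_singleton in hS. destruct hS as [hS1 [hS2 hS3]]. simpl in hS1, hS3.
  (* A solution is continuous on [0, +oo) only; freezing it at its initial value for negative times
     gives the global continuity used above. *)
  set (v := fun s => u (Rmax 0 s)). set (v' := fun s => u' (Rmax 0 s)).
  assert (hv : forall s, 0 <= s -> v s = u s) by (intros s hs; unfold v; now rewrite Rmax_right).
  assert (hv' : forall s, 0 <= s -> v' s = u' s) by (intros s hs; unfold v'; now rewrite Rmax_right).
  assert (hv0 : v 0 = u0) by (rewrite hv; [assumption | lra]).
  assert (hv'0 : v' 0 = u1) by (rewrite hv'; [assumption | lra]).
  assert (cv : forall s, continuous v s) by (intro s; now apply continuous_on_extend).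
  assert (cv' : forall s, continuous (U := H) v' s)
    by (intro s; now apply (continuous_on_extend (U := H))).
  assert (dv : forall s, 0 <= s -> vright_deriv (fun s => incl (v s)) s (v' s)).
  { intros s hs. rewrite hv'; [|assumption].
    assert (h : vright_deriv (fun s => incl (u s)) s (u' s)).
    { apply (filterdiff_vright_deriv H (within (Rle 0) (locally s))); [| |now apply du].
      - intros B [e he]. exists e. intros y hy hsy. apply he; [assumption | lra].
      - apply filter_le_within. }
    revert h. apply filterlim_ext_loc. apply at_right_intro. exists 1; split; [lra|].
    intros h hh. rewrite !hv; [reflexivity | lra | lra]. }
  assert (hvmild : forall s, 0 <= s ->
    is_RInt (fun x => E (s - x) (wave_force gradF (v x, v' x))) 0 s
      (minus ((v s, v' s) : phase_space sqrtA) (E s (v 0, v' 0)))).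
  { intros s hs. pose proof (hmild s hs) as h.
    rewrite !hv ?hv'; [|lra|lra|lra|lra].
    revert h. apply is_RInt_ext. intros x hx. rewrite Rmin_left in hx; [|lra].
    rewrite hv ?hv'; [reflexivity|lra|lra]. }
  assert (hen : norm (v' 0) ^ 2 + norm (sqrtA (incl (v 0))) ^ 2 < kappa).
  { rewrite hv0 hv'0. unfold en in hS2. simpl in hS2. rewrite !inner_norm in hS2. exact hS2. }
  assert (hk1 : kappa <= sigma / 2) by apply Rmin_l.
  assert (hk2 : kappa <= k0 / 2) by apply Rmin_r.
  assert (hr2 : (r / 2) ^ 2 <= norm (incl u0) ^ 2) by (apply pow_incr; lra).
  assert (hrp : 0 < (r / 2) ^ 2) by (apply pow_lt; lra).
  destruct (slow_decay H A sqrtA hsqrt F gradF hgrad hlip v v' cv cv' dv E hE hvmild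
    Q nu p rho R0 alpha delta K ez sigma) with (t := t) as [hz hzb]; try assumption;
    try reflexivity.
  + rewrite hv0. rewrite hv0 in hen. lra.
  + rewrite hv0. intro h. rewrite h (norm_zero (V := H)) in hr2. lra.
  + assert (Rpower ((r / 2) ^ 2) (p + 1) <= Rpower (norm (incl (v 0)) ^ 2) (p + 1)).
    { rewrite hv0. apply Rle_Rpower_l; lra. }
    assert (k0 <= K * Rpower (norm (incl (v 0)) ^ 2) (p + 1))
      by (apply Rmult_le_compat_l; lra).
    lra.
  + rewrite (hv t ht) in hz hzb. rewrite hv0 in hzb.
    rewrite -(sqrt_pow2 (norm (incl (u t)))); [|apply norm_ge_0].
    apply Rpower_inverse_bound; try assumption; [unfold N; lra|].
    assert (hY0 : Rpower (norm (incl u0) ^ 2) (- p / 2) <= Y).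
    { unfold Y. replace (- p / 2) with (- (p / 2)) by field. rewrite !Rpower_Ropp.
      apply Rinv_le_contravar; [apply Rpower_pos|]. apply Rle_Rpower_l; lra. }
    unfold N. nra.
Qed.
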